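(* There exists a function $f \in X_2$ such that $$\|f\|_{L^\infty(D(0,1))} = \infty .$$
   Context: $D(0,1)$ is the unit disc in $\mathbb{R}^2$ centered at the origin, and $\|\cdot\|_{L^\infty(D(0,1))}$ is the essential supremum over $D(0,1)$ (equal to $\infty$ if the function is not essentially bounded there). The space $X_2$ consists of the (complex-valued) functions in $L^1(\mathbb{R}^2)$ whose Fourier transforms vanish on all circles (centered at the origin) of radius $\sqrt{l^2+k^2}$ with $k,l$ integers: $$X_2 = \{ f \in L^1(\mathbb{R}^2) : \hat f(\mathbf{r}) = 0 \text{ whenever } |\mathbf{r}| = \sqrt{l^2+k^2} \text{ for some } (k,l) \in \mathbb{Z}^2 \},$$ where $\hat f(\xi) = \int_{\mathbb{R}^2} f(x) e^{-2\pi i x\cdot\xi}\,dx$. *)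

(* Defs.v *)
From HB Require Import structures.
From mathcomp Require Import all_boot all_order all_algebra.
From mathcomp Require Import all_classical all_reals all_analysis.
From mathcomp Require Import measurable_realfun complex.

Set Implicit Arguments.
Unset Strict Implicit.
Unset Printing Implicit Defensive.

Import Order.TTheory GRing.Theory Num.Theory.
Import numFieldNormedType.Exports.

Local Open Scope classical_set_scope.
Local Open Scope ring_scope.
Local Open Scope complex_scope.

(* [measurableTypeR R] is R as the measurable space that [lebesgue_measure] is
   a measure on; functions on [plane R] are functions on R^2. *)
Notation plane R := (measurableTypeR R * measurableTypeR R)%type.

(* Two-dimensional Lebesgue measure on the Borel sets. Working with Borel
   functions loses nothing: every function measurable for the completed measure
   is almost everywhere equal to a Borel one. *)
Definition lebesgue2 (R : realType) : {measure set (plane R) -> \bar R} :=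
  (@lebesgue_measure R \x @lebesgue_measure R)%E.

(* The library's norm on a product is the sup norm, so the Euclidean structure
   is spelled out. *)
Definition dot2 (R : realType) (x y : plane R) : R :=
  (x.1 : R) * (y.1 : R) + (x.2 : R) * (y.2 : R).

Definition norm2 (R : realType) (x : plane R) : R := Num.sqrt (dot2 x x).

(* The library's modulus `|z| has type R[i]; its imaginary part is 0. *)
Definition cmod (R : realType) (z : R[i]) : R := complex.Re `|z|.

(* exp (i t) for real t. *)
Definition expi (R : realType) (t : R) : R[i] := cos t +i* sin t.

Definition Cmeasurable (R : realType) (f : plane R -> R[i]) : Prop :=
  measurable_fun setT (fun x => complex.Re (f x)) /\
  measurable_fun setT (fun x => complex.Im (f x)).

Definition L1 (R : realType) : set (plane R -> R[i]) :=
  [set f | Cmeasurable f /\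
           (\int[@lebesgue2 R]_x (cmod (f x))%:E < +oo)%E].
Arguments L1 : clear implicits.

(* Meaningful for f in L1, where both integrals are finite. *)
Definition Cintegral (R : realType) (f : plane R -> R[i]) : R[i] :=
  (\int[@lebesgue2 R]_x complex.Re (f x)) +i*
  (\int[@lebesgue2 R]_x complex.Im (f x)).

Definition fourier (R : realType) (f : plane R -> R[i]) (xi : plane R) : R[i] :=
  Cintegral (fun x => f x * expi (- (2 * pi * dot2 x xi))).

Definition X2 (R : realType) : set (plane R -> R[i]) :=
  [set f | L1 R f /\
     forall r : plane R,
       (exists k l : int, norm2 r = Num.sqrt (l%:~R ^+ 2 + k%:~R ^+ 2)) ->
       fourier f r = 0].
Arguments X2 : clear implicits.

Definition unit_disc (R : realType) : set (plane R) := [set x | norm2 x < 1].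
Arguments unit_disc : clear implicits.

Lemma measurable_unit_disc (R : realType) : measurable (unit_disc R).
Proof.
have m1 : measurable_fun setT (fun x : plane R => dot2 x x).
  by apply: measurable_funD; apply: measurable_funM;
    [exact: measurable_fst|exact: measurable_fst|
     exact: measurable_snd|exact: measurable_snd].
rewrite (_ : unit_disc R = setT `&` (fun x : plane R => dot2 x x) @^-1` `]-oo, 1[).
  exact: m1.
have sqrt_lt1 (t : R) : (Num.sqrt t < 1) = (t < 1).
  by rewrite -[in LHS]sqrtr1 ltr_sqrt.
by rewrite setTI; apply/seteqP; split => x; rewrite /unit_disc /norm2 /= in_itv /= sqrt_lt1.
Qed.

(* L^oo norm over the unit disc, i.e. for Lebesgue measure restricted to it. *)
Definition Linfty_norm_disc (R : realType) (f : plane R -> R[i]) : \bar R :=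
  Lnorm (mrestr (@lebesgue2 R) (@measurable_unit_disc R)) +oo%E
        (fun x => (cmod (f x))%:E).

(* Main.v *)
Require Import Defs.
From HB Require Import structures.
From mathcomp Require Import all_boot all_order all_algebra.
From mathcomp Require Import finfield.
From mathcomp Require Import all_classical all_reals all_analysis.
From mathcomp Require Import measurable_realfun ess_sup_inf.
From mathcomp Require Import complex.
From mathcomp Require Import ring lra zify.

Set Implicit Arguments.
Unset Strict Implicit.
Unset Printing Implicit Defensive.

Import Order.TTheory GRing.Theory Num.Theory.
Import numFieldNormedType.Exports.

Local Open Scope ring_scope.

(** The function is a sum of spikes. For a small ep > 0 the Gaussian
    exp (- pi |x|^2 / ep) has height 1 and integral ep. Suppose that it can be
    corrected by a function e, whose supremum and whose L^1 norm are at most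
    delta, in such a way that the difference has a Fourier transform vanishing
    on all the circles ([exists_bump]). Taking delta = 2^-(k+1) and ep <= delta
    for the k-th spike, the series of the spikes converges in L^1, so that its
    sum still has a Fourier transform vanishing on the circles. Near the origin
    the first K Gaussians add up to at least K / 2, the others are positive,
    and all the corrections together contribute at most 1: the sum exceeds
    every constant near the origin.

    A correction exists because sums of two squares are rare. If a prime
    p = 3 mod 4 divides n exactly once, then n is not a sum of two squares, so
    the sums of two squares lie in the set Z of the integers which no such
    p < y divides exactly once. This set is periodic, its period Q is a product
    of squares p^2, and its density d is the product of the numbers
    1 - 1/p + 1/p^2. As the sum of 1/p over the primes p = 3 mod 4 diverges
    ([prod_prime3mod4_unbounded]), d is as small as desired ([sparse_period]).

    Let c_j (j < Q) be the discrete Fourier coefficients of the indicator of Z,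
    and z_j = ep + 2 i j / Q. At a point xi with |xi|^2 = n in Z, the function
    ep * sum_j c_j exp (- pi z_j |xi|^2) equals ep * exp (- pi ep n), which is
    the Fourier transform of the Gaussian of height 1 at xi. This function is
    the Fourier transform of the mixture of complex Gaussians
    e (x) = ep * sum_j c_j z_j^-1 exp (- pi |x|^2 / z_j), which is the
    correction. When ep tends to 0 with Q fixed, the terms of e become
    orthogonal in L^2, even for the measure with density
    (1 + ep x_1^2) (1 + ep x_2^2), and Parseval's formula gives a weighted
    square norm of order ep * d ([correction_weighted]). As the inverse of the
    weight has integral pi^2 / ep, the Cauchy-Schwarz inequality bounds the L^1
    norm of e by a multiple of the square root of d. In the supremum of |e|
    only the term j = 0 matters, and it is d ([correction_sup]).

    The Fourier transform of exp (- pi w |x|^2) for complex w comes from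
    two linear differential equations for the integral over the line of
    exp (- pi w x^2 - 2 i pi eta x): one in the imaginary part of w
    ([moment0_sqr]) and one in eta ([moment_eta]). *)

(** * Primes congruent to 3 modulo 4 *)

Definition prime3mod4 (p : nat) := prime p && (p %% 4 == 3)%N.

(** If p did not divide k, then k^2 = - l^2 modulo p with l invertible. Raising
    this to the odd power (p - 1) / 2 gives 1 = - 1 by Fermat's little theorem. *)
Lemma sum_two_squares_dvd (p k l : nat) : prime3mod4 p ->
  (p %| k ^ 2 + l ^ 2 -> p %| k)%N.
Proof.
case/andP=> pp /eqP p3 pkl; apply: contraT => pk.
have pp1 : (1 < p)%N by exact: prime_gt1.
have cF m : (m%:R == 0 :> 'F_p) = (p %| m)%N.
  have := @pchar_Fp p pp.
  by move/dvdn_pcharf => ->.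
have E : (k%:R ^+ 2 : 'F_p) = - (l%:R ^+ 2).
  apply/eqP; rewrite -addr_eq0 -!natrX -natrD cF //.
have fer (x : 'F_p) : x != 0 -> x ^+ p.-1 = 1.
  move=> x0; have := @expf_card _ x; rewrite card_Fp // => xp.
  apply: (mulfI x0); rewrite mulr1 -exprS prednK //; exact: ltnW.
set m := (p.-1 %/ 2)%N.
have pm : p.-1 = (2 * m)%N by rewrite /m; lia.
have om : odd m by rewrite /m; lia.
have kF : (k%:R : 'F_p) != 0 by rewrite cF.
have := fer _ kF; rewrite pm exprM E exprNn -signr_odd om expr1 -exprM -pm.
have [l0|l0] := eqVneq (l%:R : 'F_p) 0.
  rewrite l0 expr0n; have -> : (p.-1 == 0)%N = false by lia.
  by rewrite mulr0 => /eqP; rewrite eq_sym oner_eq0.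
rewrite fer // mulr1 => /eqP; rewrite eq_sym -addr_eq0.
by rewrite -(natrD _ 1 1) cF => /dvdn_leq; lia.
Qed.

Lemma sum_multiples (V : nmodType) (p : nat) (F : nat -> V) (x : nat) :
  (0 < p)%N ->
  \sum_(1 <= n < x.+1 | (p %| n)%N) F n = \sum_(1 <= m < (x %/ p).+1) F (p * m)%N.
Proof.
move=> p0; elim: x => [|x IH]; first by rewrite div0n !big_nil.
rewrite big_mkcond big_nat_recr //= -big_mkcond IH divnS //.
case: ifP => [d|_]; last by rewrite addr0.
rewrite /= addnC addn1 (big_nat_recr (x %/ p).+1) //=; congr (_ + F _).
by rewrite -[in LHS](divnK d) divnS // d mulnC.
Qed.

Lemma forall_ordS (P : pred nat) (y : nat) :
  [forall p : 'I_y.+1, P p] = [forall p : 'I_y, P p] && P y.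
Proof.
apply/idP/idP.
  move/forallP => h; apply/andP; split; last exact: (h ord_max).
  by apply/forallP => p; exact: (h (widen_ord (leqnSn y) p)).
case/andP => /forallP h hy; apply/forallP => p.
have [py|yp] := ltnP p y; first exact: (h (Ordinal py)).
by have -> : (p : nat) = y by apply/eqP; rewrite eqn_leq yp -ltnS ltn_ord.
Qed.

Section Sieve.
Variable R : realType.

Definition chi4 (n : nat) : R :=
  if (n %% 4 == 1)%N then 1 else if (n %% 4 == 3)%N then -1 else 0.

Lemma chi4M (m n : nat) : chi4 (m * n) = chi4 m * chi4 n.
Proof.
rewrite /chi4 -modnMm.
have := @ltn_pmod m 4 isT; have := @ltn_pmod n 4 isT.
by case: (m %% 4)%N => [|[|[|[|?]]]] //; case: (n %% 4)%N => [|[|[|[|?]]]] //= _ _;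
  rewrite ?mul0r ?mulr0 ?mul1r ?mulr1 ?mulrNN ?mulr1.
Qed.

(** The series 1 - 1/3 + 1/5 - ... alternates, with decreasing terms. *)
Lemma chi4_sum_bound (x : nat) :
  `|\sum_(1 <= n < x.+1) chi4 n / n%:R| <= 1.
Proof.
pose T x := \sum_(1 <= n < x.+1) chi4 n / n%:R.
have TS y : T y.+1 = T y + chi4 y.+1 / y.+1%:R by rewrite /T big_nat_recr.
have T4 m : 0 <= T (4 * m)%N /\ T (4 * m)%N + (4 * m).+1%:R^-1 <= 1.
  elim: m => [|m [IH1 IH2]].
    by rewrite muln0 /T big_nil add0r invr1.
  rewrite mulnS addnC addn4 !TS.
  have -> : chi4 (4 * m).+1 = 1 by rewrite /chi4; have -> : ((4 * m).+1 %% 4 = 1)%N by lia.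
  have -> : chi4 (4 * m).+2 = 0 by rewrite /chi4; have -> : ((4 * m).+2 %% 4 = 2)%N by lia.
  have -> : chi4 (4 * m).+3 = -1 by rewrite /chi4; have -> : ((4 * m).+3 %% 4 = 3)%N by lia.
  have -> : chi4 (4 * m).+4 = 0 by rewrite /chi4; have -> : ((4 * m).+4 %% 4 = 0)%N by lia.
  have h1 : (4 * m).+3%:R^-1 <= (4 * m).+1%:R^-1 :> R.
    by rewrite lef_pV2 ?posrE ?ltr0n // ler_nat; lia.
  have h2 : (4 * m).+4.+1%:R^-1 <= (4 * m).+3%:R^-1 :> R.
    by rewrite lef_pV2 ?posrE ?ltr0n // ler_nat; lia.
  rewrite !mul1r !mul0r !mulN1r.
  by move: IH1 IH2 h1 h2; move: (T _) (_^-1) (_^-1) (_^-1) => t a b c *; split; lra.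
have pos y : 0 <= y.+1%:R^-1 :> R by rewrite invr_ge0.
rewrite -/(T x).
have [IH1 IH2] := T4 (x %/ 4)%N; have := pos (4 * (x %/ 4))%N.
have h1 : (4 * (x %/ 4)).+3%:R^-1 <= (4 * (x %/ 4)).+1%:R^-1 :> R.
  by rewrite lef_pV2 ?posrE ?ltr0n // ler_nat; lia.
have h3 := pos (4 * (x %/ 4)).+2.
have E1 : chi4 (4 * (x %/ 4)).+1 = 1 by rewrite /chi4;
  have -> : ((4 * (x %/ 4)).+1 %% 4 = 1)%N by lia.
have E2 : chi4 (4 * (x %/ 4)).+2 = 0 by rewrite /chi4;
  have -> : ((4 * (x %/ 4)).+2 %% 4 = 2)%N by lia.
have E3 : chi4 (4 * (x %/ 4)).+3 = -1 by rewrite /chi4;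
  have -> : ((4 * (x %/ 4)).+3 %% 4 = 3)%N by lia.
have : x = ((4 * (x %/ 4)) + x %% 4)%N by lia.
have := @ltn_pmod x 4 isT.
case: (x %% 4)%N => [|[|[|[|?]]]] // _; rewrite ?addnS addn0 => xE h0.
all: rewrite xE ?TS ?E1 ?E2 ?E3 ?mul1r ?mul0r ?mulN1r ler_norml.
all: move: IH1 IH2 h0 h1 h3; move: (T _) (_.+1%:R^-1) (_.+3%:R^-1) => t a b *.
all: by apply/andP; split; lra.
Qed.

Definition rough3mod4 (y n : nat) := [forall p : 'I_y, prime3mod4 p ==> ~~ (p %| n)%N].

Definition rough_sum (w : nat -> R) (y x : nat) : R :=
  \sum_(1 <= n < x.+1 | rough3mod4 y n) w n / n%:R.

Lemma rough3mod4S y n : rough3mod4 y.+1 n = rough3mod4 y n && (prime3mod4 y ==> ~~ (y %| n)%N).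
Proof. exact: (forall_ordS (fun p => prime3mod4 p ==> ~~ (p %| n)%N)). Qed.

Lemma rough3mod4M p m : prime3mod4 p -> rough3mod4 p (p * m) = rough3mod4 p m.
Proof.
case/andP=> pp _; apply: eq_forallb => q; case qp : (prime3mod4 q) => //=.
rewrite Euclid_dvdM; last by case/andP: qp.
rewrite dvdn_prime2 //; last by case/andP: qp.
by rewrite (ltn_eqF (ltn_ord q)).
Qed.

(** The multiples of p which survive the sieve by the smaller primes are the
    products p m, where m survives it as well. *)
Lemma rough_sumS w p x : prime3mod4 p -> (forall m n, w (m * n)%N = w m * w n) ->
  rough_sum w p x = rough_sum w p.+1 x + w p / p%:R * rough_sum w p (x %/ p).
Proof.
move=> pp wM; have p0 : (0 < p)%N by case/andP: pp => /prime_gt0.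
rewrite /rough_sum (bigID (fun n => p %| n)%N) /= addrC; congr (_ + _).
  by apply: eq_bigl => n; rewrite rough3mod4S pp.
rewrite (eq_bigl (fun n => (p %| n)%N && rough3mod4 p n)); last by move=> n; rewrite andbC.
rewrite big_mkcondr sum_multiples // mulr_sumr -big_mkcond /= [LHS](eq_bigl (rough3mod4 p)).
  apply: eq_bigr => m _; rewrite wM natrM invfM; ring.
by move=> m; rewrite rough3mod4M.
Qed.

Definition odd_indicator (n : nat) : R := (odd n)%:R.

Lemma rough_sum0 w x : rough_sum w 0 x = \sum_(1 <= n < x.+1) w n / n%:R :> R.
Proof.
by apply: eq_bigl => n; apply/forallP => -[].
Qed.

Lemma rough_sum_step0 w y x : ~~ prime3mod4 y -> rough_sum w y.+1 x = rough_sum w y x :> R.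
Proof. by move=> ny; apply: eq_bigl => n; rewrite rough3mod4S (negPf ny) andbT. Qed.

(** As chi4 p = - 1, sieving out p adds 1/p times the sum up to x / p to the
    sum up to x, so that a bound uniform in x gets multiplied by 1 + 1/p. The
    bound before sieving is that of the alternating series. *)
Lemma chi4_rough_sum y x :
  `|rough_sum chi4 y x| <= \prod_(p < y | prime3mod4 p) (1 + p%:R^-1).
Proof.
elim: y x => [|y IH] x.
  by rewrite big_ord0 rough_sum0 chi4_sum_bound.
rewrite big_mkcond big_ord_recr -big_mkcond /=; case: ifP => [yp|/negbT ny]; last first.
  by rewrite mulr1 rough_sum_step0.
have := rough_sumS x yp chi4M.
have -> : chi4 y = -1 by rewrite /chi4; case/andP: yp => _ /eqP ->.
rewrite mulN1r mulNr => /eqP; rewrite eq_sym subr_eq => /eqP ->.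
apply: le_trans (ler_normD _ _) _; rewrite mulrDr mulr1 lerD // normrM ger0_norm ?invr_ge0 //.
by rewrite mulrC ler_wpM2r ?invr_ge0.
Qed.

Lemma rough_sum_homo y x x' : (x <= x')%N ->
  rough_sum odd_indicator y x <= rough_sum odd_indicator y x'.
Proof.
move=> xx'; rewrite /rough_sum (@big_cat_nat _ _ _ x.+1 1 x'.+1) //= lerDl.
by apply: sumr_ge0 => n _; rewrite mulr_ge0 ?invr_ge0 ?ler0n.
Qed.

Lemma odd_indicatorM m n : odd_indicator (m * n) = odd_indicator m * odd_indicator n.
Proof. by rewrite /odd_indicator oddM -mulnb natrM. Qed.

(** For the principal character the sieve subtracts 1/p times the sum up to
    x / p, which is at most the sum up to x. *)
Lemma odd_rough_sum y x :
  (\prod_(p < y | prime3mod4 p) (1 - p%:R^-1)) * \sum_(1 <= n < x.+1) odd_indicator n / n%:R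
  <= rough_sum odd_indicator y x.
Proof.
elim: y => [|y IH]; first by rewrite big_ord0 mul1r rough_sum0.
rewrite big_mkcond big_ord_recr -big_mkcond /=; case: ifP => [yp|/negbT ny]; last first.
  by rewrite mulr1 rough_sum_step0.
have y1 : (1 < y)%N by case/andP: yp => /prime_gt1.
have iy : y%:R^-1 <= 1 :> R by rewrite invf_le1 ?ler1n ?ltr0n; lia.
have := rough_sumS x yp odd_indicatorM.
have -> : odd_indicator y = 1 by rewrite /odd_indicator; case/andP: yp => _ y3;
  have -> : odd y by lia.
rewrite mul1r => /eqP; rewrite -subr_eq => /eqP <-.
rewrite mulrAC; apply: le_trans (_ : rough_sum odd_indicator y x * (1 - y%:R^-1) <= _).
  by rewrite ler_wpM2r ?subr_ge0.
rewrite mulrBr mulr1 lerD2l lerN2 [leRHS]mulrC ler_wpM2l ?invr_ge0 //.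
by rewrite rough_sum_homo // leq_div.
Qed.

Lemma rough3mod4_eq1 y n : (0 < n < y)%N -> odd n -> rough3mod4 y n -> (n %% 4 = 1)%N.
Proof.
elim/ltn_ind: n => n IH /andP[n0 ny] on rn.
have [n1|n1] := leqP n 1; first by have -> : n = 1%N by lia.
have pp := pdiv_prime n1; have pn := pdiv_dvd n.
set p := pdiv n in pp pn *.
have [m nE] := dvdnP pn.
have p0 := prime_gt1 pp.
have py : (p < y)%N by have := dvdn_leq n0 pn; lia.
have op : odd p by move: on; rewrite nE oddM => /andP[].
have p1 : (p %% 4 = 1)%N.
  move/forallP: rn => /(_ (Ordinal py)) /=; rewrite pn /prime3mod4 pp /= implybF => p3.
  by lia.
have m1 : (m %% 4 = 1)%N.
  have m0 : (0 < m)%N by case: m nE => // nE; lia.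
  have mn : (m < n)%N by rewrite nE ltn_Pmulr // prime_gt1.
  have om : odd m by move: on; rewrite nE oddM => /andP[].
  apply: IH => //; first by rewrite m0 (ltn_trans mn).
  apply/forallP => q; apply/implyP => q3.
  move/forallP: rn => /(_ q) /implyP /(_ q3); apply: contra => qm.
  by rewrite nE dvdn_mulr.
by rewrite nE -modnMm m1 p1.
Qed.

(** The odd numbers up to x which survive the sieve are products of primes
    congruent to 1 modulo 4, and chi4 is 1 there. *)
Lemma chi4_odd_rough x : rough_sum chi4 x.+1 x = rough_sum odd_indicator x.+1 x.
Proof.
rewrite /rough_sum big_nat_cond [RHS]big_nat_cond; apply: eq_bigr => n /andP[nx rn].
congr (_ / _); rewrite /chi4 /odd_indicator; case on : (odd n).
  by rewrite (rough3mod4_eq1 _ on rn).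
by case: ifP => [|_]; first lia; case: ifP => [|_ //]; lia.
Qed.

(** The odd numbers between 2^k and 2^(k+2) contribute at least 1/4. *)
Lemma odd_harmonic_unbounded (A : R) : exists x : nat,
  A <= \sum_(1 <= n < x.+1) odd_indicator n / n%:R.
Proof.
have step k : 1 / 4 <= \sum_((2 ^ k).+1 <= n < (2 ^ k.+2).+1) odd_indicator n / n%:R.
  have k0 : (0 < 2 ^ k)%N by rewrite expn_gt0.
  have -> : (2 ^ k.+2 = 2 ^ k + 2 * 2 ^ k + 2 ^ k)%N by rewrite !expnS; lia.
  set a := (2 ^ k)%N.
  suff h j : j%:R / (4 * a%:R) <=
      \sum_(a.+1 <= n < (a + 2 * j).+1) odd_indicator n / n%:R \/ (a < j)%N.
    have [h1|//] := h a; last by lia.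
    rewrite (@big_cat_nat _ _ _ (a + 2 * a).+1) //=; [|lia|lia].
    apply: le_trans (_ : a%:R / (4 * a%:R) <= _).
      by rewrite invfM mulrCA divff ?mulr1 ?mul1r // pnatr_eq0; lia.
    apply: le_trans h1 _; rewrite lerDl.
    by apply: sumr_ge0 => n _; rewrite mulr_ge0 ?invr_ge0 ?ler0n.
  elim: j => [|j [IH|]]; [left|..]; last by right; lia.
    by rewrite mul0r muln0 addn0 big_geq.
  have [ja|] := leqP j.+1 a; last by right.
  left; have -> : (a + 2 * j.+1 = (a + 2 * j).+2)%N by lia.
  rewrite big_nat_recr /=; last by lia.
  rewrite big_nat_recr /=; last by lia.
  rewrite -addrA -natr1 mulrDl mul1r lerD //.
  have inv n : (0 < n <= 4 * a)%N -> (4 * a%:R)^-1 <= n%:R^-1 :> R.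
    by move=> /andP[n0 na]; rewrite -(natrM _ 4) lef_pV2 ?posrE ?ltr0n ?ler_nat //; lia.
  have i1 := inv (a + 2 * j).+1; have i2 := inv (a + 2 * j).+2.
  rewrite /odd_indicator /=; case: (odd (a + 2 * j)%N); rewrite /= ?mulr0n ?mulr1n.
    by rewrite mul0r add0r mul1r i2 //; lia.
  by rewrite mul0r addr0 mul1r i1 //; lia.
have h m : m%:R / 4 <= \sum_(1 <= n < (2 ^ (2 * m)).+1) odd_indicator n / n%:R.
  elim: m => [|m IH].
    by rewrite mul0r; apply: sumr_ge0 => n _; rewrite mulr_ge0 ?invr_ge0 ?ler0n.
  rewrite (@big_cat_nat _ _ _ (2 ^ (2 * m)).+1) //=; last first.
    by rewrite ltnS leq_exp2l //; lia.
  rewrite -natr1 mulrDl lerD //.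
  by have -> : (2 * m.+1 = (2 * m).+2)%N by lia.
exists (2 ^ (2 * Num.bound (4 * A)))%N; apply: le_trans (h _).
have := archi_boundP (normr_ge0 (4 * A)).
have -> : Num.bound `|4 * A| = Num.bound (4 * A) by rewrite /Num.bound normr_id.
have := ler_norm (4 * A); lra.
Qed.

(** The two estimates of the same sum say that the sum of the inverses of the
    odd numbers up to x is at most the product of the (1 + 1/p) / (1 - 1/p).
    As (1 - t) (1 + t)^2 >= 1 for 0 <= t <= 1/2, this quotient is at most
    (1 + 1/p)^3, whence the divergence. *)
Lemma prod_prime3mod4_unbounded (A : R) : 0 < A -> exists y : nat,
  A <= \prod_(p < y | prime3mod4 p) (1 + p%:R^-1).
Proof.
move=> A0; have [x hx] := odd_harmonic_unbounded (A ^+ 3); exists x.+1.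
set P := \prod_(_ < _ | _) _.
have P0 : 0 < P by apply: prodr_gt0 => p _; rewrite ltr_pwDl ?ltr01 ?invr_ge0.
rewrite -(@ler_pXn2r _ 3 isT A P) ?nnegrE; [|exact: ltW|exact: ltW].
apply: le_trans hx _.
set S := \sum_(_ <= _ < _) _.
have S0 : 0 <= S by apply: sumr_ge0 => n _; rewrite mulr_ge0 ?invr_ge0 ?ler0n.
have h : \prod_(p < x.+1 | prime3mod4 p) (1 - p%:R^-1) * S <= P.
  apply: le_trans (odd_rough_sum _ _) _; rewrite -chi4_odd_rough.
  exact: le_trans (ler_norm _) (chi4_rough_sum _ _).
suff h2 : 1 <= P ^+ 2 * \prod_(p < x.+1 | prime3mod4 p) (1 - p%:R^-1).
  have : P ^+ 2 * (\prod_(p < x.+1 | prime3mod4 p) (1 - p%:R^-1) * S) <= P ^+ 2 * P.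
    by rewrite ler_wpM2l // exprn_ge0 // ltW.
  by rewrite -exprSr mulrA; apply: le_trans; rewrite ler_peMl.
rewrite /P -prodrXl -big_split /=; elim/big_ind : _ => // [a b a1 b1|p /andP[pp _]].
  by rewrite -[1]mulr1 ler_pM.
have : p%:R^-1 <= 2^-1 :> R.
  by rewrite lef_pV2 ?posrE ?ltr0n ?ler_nat ?prime_gt1 ?prime_gt0.
have : 0 <= p%:R^-1 :> R by rewrite invr_ge0.
move: (p%:R^-1) => t; nra.
Qed.

End Sieve.

(** * A sparse periodic set containing the sums of two squares *)

Definition exact_dvd (p n : nat) := ((p %| n) && ~~ (p ^ 2 %| n))%N.
Definition sieved (y n : nat) := [forall p : 'I_y, prime3mod4 p ==> ~~ exact_dvd p n].
Definition period (y : nat) := (\prod_(p < y | prime3mod4 p) p ^ 2)%N.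

(** If p divides k^2 + l^2, then it divides k and l, so p^2 divides the sum. *)
Lemma sieved_two_squares y k l : sieved y (k ^ 2 + l ^ 2).
Proof.
apply/forallP => p; apply/implyP => p3; rewrite /exact_dvd negb_and negbK.
case pkl : (p %| _)%N => //=.
have pk := sum_two_squares_dvd p3 pkl.
have pl : (p %| l)%N by apply: (sum_two_squares_dvd (l := k) p3); rewrite addnC.
by rewrite dvdn_add // dvdn_exp2r.
Qed.

Lemma exact_dvd_mod p m n : (p ^ 2 %| m)%N -> exact_dvd p (n %% m) = exact_dvd p n.
Proof.
move=> pm; have dm d : (d %| m)%N -> (d %| n %% m)%N = (d %| n)%N.
  by move=> dm; rewrite /dvdn modn_dvdm.
by rewrite /exact_dvd !dm // (dvdn_trans _ pm) // dvdn_exp.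
Qed.

Lemma sieved_mod y n : sieved y (n %% period y) = sieved y n.
Proof.
apply: eq_forallb => p; case p3 : (prime3mod4 p) => //=.
have pp : (p ^ 2 %| period y)%N by rewrite /period (bigD1 p) //= dvdn_mulr.
by rewrite exact_dvd_mod.
Qed.

Lemma sum_chinese (A B : nat) (f g : nat -> nat) : (0 < A)%N -> (0 < B)%N ->
  coprime A B ->
  (\sum_(n < A * B) f (n %% A) * g (n %% B) =
   (\sum_(n < A) f n) * (\sum_(n < B) g n))%N.
Proof.
move=> A0 B0 cAB.
rewrite big_distrlr /= pair_bigA /=.
pose h (n : 'I_(A * B)) := (Ordinal (ltn_pmod n A0), Ordinal (ltn_pmod n B0)).
rewrite (reindex h) //; apply: onW_bij; apply: inj_card_bij.
  move=> m n [] eA eB; apply/val_inj => /=.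
  rewrite -(modn_small (ltn_ord m)) -(modn_small (ltn_ord n)).
  by apply/eqP; rewrite chinese_remainder // eA eB !eqxx.
by rewrite card_prod !card_ord.
Qed.

Lemma count_not_exact p : (1 < p)%N ->
  (\sum_(n < p ^ 2) ~~ exact_dvd p n = p ^ 2 - p + 1)%N.
Proof.
move=> p1; have p0 := ltnW p1; have pp0 : (0 < p ^ 2)%N by rewrite expn_gt0 p0.
suff h : (\sum_(n < p ^ 2) exact_dvd p n = p.-1)%N.
  have : (\sum_(n < p ^ 2) (exact_dvd p n + ~~ exact_dvd p n) = p ^ 2)%N.
    rewrite (eq_bigr (fun=> 1%N)); last by move=> n _; case: exact_dvd.
    by rewrite sum1_card card_ord.
  rewrite big_split /= h; move: (\sum_(_ < _) _)%N => s; nia.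
have h1 : (\sum_(1 <= i < (p ^ 2).+1) (p %| i) = p)%N.
  by rewrite -divn_count_dvd -mulnn mulnK.
have h2 : (\sum_(1 <= i < (p ^ 2).+1) (p ^ 2 %| i) = 1)%N.
  by rewrite -divn_count_dvd divnn pp0.
have h3 : (\sum_(1 <= i < (p ^ 2).+1) (exact_dvd p i + (p ^ 2 %| i)) = p)%N.
  rewrite -[RHS]h1; apply: eq_bigr => i _; rewrite /exact_dvd.
  case d2 : (p ^ 2 %| i)%N => /=; last by rewrite addn0 andbT.
  by rewrite andbF (dvdn_trans _ d2) // dvdn_exp.
move: h3; rewrite big_split /= h2 addn1 => /(congr1 predn) /= <-.
rewrite -[LHS](big_mkord xpredT (fun n => exact_dvd p n : nat)).
rewrite big_nat_recr //= [in LHS]big_ltn //.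
have -> : exact_dvd p 0 = false by rewrite /exact_dvd !dvdn0.
have -> : exact_dvd p (p ^ 2) = false by rewrite /exact_dvd dvdnn andbF.
exact: addnC.
Qed.

Lemma period_gt0 y : (0 < period y)%N.
Proof. by apply: prodn_cond_gt0 => p /andP[/prime_gt0 p0 _]; rewrite expn_gt0 p0. Qed.

Lemma sievedS y n : sieved y.+1 n = sieved y n && (prime3mod4 y ==> ~~ exact_dvd y n).
Proof. exact: (forall_ordS (fun p => prime3mod4 p ==> ~~ exact_dvd p n)). Qed.

Lemma count_sieved y :
  (\sum_(n < period y) sieved y n = \prod_(p < y | prime3mod4 p) (p ^ 2 - p + 1))%N.
Proof.
elim: y => [|y IH].
  rewrite /period !big_ord0 big_ord_recr big_ord0 /= add0n.
  by have -> : sieved 0 0 by apply/forallP => -[].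
have pE : period y.+1 = (period y * (if prime3mod4 y then y ^ 2 else 1))%N.
  by rewrite /period big_mkcond big_ord_recr -big_mkcond.
rewrite [RHS]big_mkcond big_ord_recr -[X in _ = (X * _)%N]big_mkcond /= pE; case: ifP => y3;
  last first.
  rewrite !muln1 -IH; apply: eq_bigr => n _.
  by rewrite sievedS y3 andbT.
have yp : prime y by case/andP: y3.
rewrite -IH -count_not_exact ?prime_gt1 //.
rewrite -[RHS](sum_chinese (fun n => sieved y n : nat) (fun n => ~~ exact_dvd y n : nat));
  first last.
- rewrite coprimeXr // /period; elim/big_ind : _ => [|a b ca cb|q /andP[qp _]].
  + exact: coprime1n.
  + by rewrite coprimeMl ca.
  + rewrite coprimeXl // prime_coprime // dvdn_prime2 //.
    by rewrite (ltn_eqF (ltn_ord q)).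
- by rewrite expn_gt0 prime_gt0.
- exact: period_gt0.
by apply: eq_bigr => n _; rewrite sievedS y3 /= sieved_mod exact_dvd_mod // mulnb.
Qed.

(** With t = 1/p the density is the product of the 1 - t + t^2, and
    (1 + t) (1 - t + t^2) = 1 + t^3. So the density times the unbounded product
    of the 1 + t is at most the product of the 1 + n^-3 for n >= 2, which is
    at most 2 by comparison with that of n^2 / (n^2 - 1). *)
Lemma sparse_period (R : realType) (d : R) : 0 < d ->
  exists y : nat, (\sum_(n < period y) sieved y n)%N%:R <= d * (period y)%:R.
Proof.
move=> d0; have [|y hy] := @prod_prime3mod4_unbounded R (2 / d); first by rewrite divr_gt0.
exists y; rewrite count_sieved /period !natr_prod.
set P := \prod_(_ < _ | _) _ in hy.
have P0 : 0 < P by apply: lt_le_trans hy; rewrite divr_gt0.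
have cube : \prod_(p < y | prime3mod4 p) (1 + p%:R^-1 ^+ 3) <= 2 :> R.
  (* the product of n^2 / (n^2 - 1) for 2 <= n <= z + 1 telescopes to this *)
  suff h z : \prod_(p < z.+2 | prime3mod4 p) (1 + p%:R^-1 ^+ 3) <= 2 - 2 / (z.+2)%:R :> R.
    apply: le_trans (_ : \prod_(p < y.+2 | prime3mod4 p) (1 + p%:R^-1 ^+ 3) <= 2); last first.
      by apply: le_trans (h y) _; rewrite lerBlDr lerDl divr_ge0.
    rewrite !(big_mkcond (fun p => prime3mod4 _)) !big_ord_recr /= -mulrA.
    have pos z : 1 <= (if prime3mod4 z then 1 + z%:R^-1 ^+ 3 else 1) :> R.
      by case: ifP => // _; rewrite lerDl exprn_ge0 // invr_ge0.
    rewrite ler_peMr //; last exact: mulr_ege1 (pos _) (pos _).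
    by apply: prodr_ge0 => p _; apply: le_trans ler01 (pos p).
  elim: z => [|z IH].
    rewrite big_mkcond !big_ord_recr big_ord0 /= divff ?pnatr_eq0 //.
    by rewrite !mul1r; lra.
  rewrite big_mkcond big_ord_recr -big_mkcond /=.
  have z0 : (z.+2)%:R != 0 :> R by rewrite pnatr_eq0.
  set a : R := z.+2%:R in IH *.
  have a1 : 2 <= a by rewrite ler_nat.
  have -> : z.+3%:R = a + 1 by rewrite -natr1.
  apply: le_trans (_ : (2 - 2 / a) * (1 + a^-1 ^+ 3) <= _).
    case: ifP => _; first by rewrite ler_wpM2r // addr_ge0 // exprn_ge0 // invr_ge0; lra.
    rewrite mulr1; apply: le_trans IH _; rewrite ler_peMr //.
      by rewrite subr_ge0 ler_pdivrMr; lra.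
    by rewrite lerDl exprn_ge0 // invr_ge0; lra.
  rewrite -subr_ge0.
  have -> : 2 - 2 / (a + 1) - (2 - 2 / a) * (1 + a^-1 ^+ 3) =
     2 * (a ^+ 2 * (a - 1) + 1) / (a ^+ 4 * (a + 1)).
    by field; rewrite !lt0r_neq0 //; lra.
  have a0 : 0 <= a - 1 by lra.
  have a2 : 0 <= a by lra.
  have a3 : 0 <= a + 1 by lra.
  apply: divr_ge0; last by rewrite mulr_ge0 // exprn_ge0.
  by rewrite mulr_ge0 // addr_ge0 // mulr_ge0 // exprn_ge0.
suff : P * \prod_(p < y | prime3mod4 p) (p ^ 2 - p + 1)%:R <=
    2 * \prod_(p < y | prime3mod4 p) (p ^ 2)%:R :> R.
  move=> h; rewrite -(ler_pM2l P0); apply: le_trans h _; rewrite mulrA ler_wpM2r //.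
    by apply: prodr_ge0.
  by move: hy; rewrite ler_pdivrMr.
apply: le_trans (_ : \prod_(p < y | prime3mod4 p) (1 + p%:R^-1 ^+ 3) *
    \prod_(p < y | prime3mod4 p) (p ^ 2)%:R <= _).
  rewrite /P -!big_split /= le_eqVlt; apply/orP; left; apply/eqP.
  apply: eq_bigr => p /andP[/prime_gt0 p0 _].
  have pn : p%:R != 0 :> R by rewrite pnatr_eq0; lia.
  have pp : (p <= p ^ 2)%N by rewrite -mulnn leq_pmulr.
  by rewrite natrD natrB // natrX; field.
by rewrite ler_wpM2r //; apply: prodr_ge0.
Qed.

(** * Functions dominated by a Gaussian *)

Local Open Scope classical_set_scope.
Local Open Scope ring_scope.

Section GaussDominated.
Variable R : realType.
Implicit Types (h F : R -> R).
Local Notation mu := (@lebesgue_measure R).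

(** The measurable functions of this class are integrable. The class is closed
    under multiplication by bounded functions and by polynomials, and its
    members vanish at infinity, which makes integration by parts possible. *)
Definition gauss_dominated h :=
  exists K c : R, 0 < c /\ forall x, `|h x| <= K * expR (- (c * x ^+ 2)).

Lemma gauss_dominated_expR (c : R) : 0 < c ->
  gauss_dominated (fun x => expR (- (c * x ^+ 2))).
Proof.
by move=> c0; exists 1, c; split => // x; rewrite mul1r ger0_norm ?expR_ge0.
Qed.

Lemma gauss_dominatedM h (b : R -> R) :
  gauss_dominated h -> (forall x, `|b x| <= 1) -> gauss_dominated (fun x => h x * b x).
Proof.
move=> [K [c [c0 hK]]] b1; exists K, c; split => // x.
by rewrite normrM -[leRHS]mulr1 ler_pM.
Qed.

Lemma gauss_dominatedZ h (k : R) : gauss_dominated h -> gauss_dominated (fun x => k * h x).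
Proof.
move=> [K [c [c0 hK]]]; exists (`|k| * K), c; split => // x.
by rewrite normrM -mulrA ler_wpM2l.
Qed.

Lemma gauss_dominatedD h F : gauss_dominated h -> gauss_dominated F ->
  gauss_dominated (fun x => h x + F x).
Proof.
move=> [K [c [c0 hK]]] [L [e [e0 FL]]].
exists (`|K| + `|L|), (Num.min c e); split => [|x]; first by rewrite lt_min c0.
apply: le_trans (ler_normD _ _) _; rewrite mulrDl lerD //.
  apply: le_trans (hK x) _; apply: le_trans (_ : `|K| * expR (- (c * x ^+ 2)) <= _).
    by rewrite ler_wpM2r ?expR_ge0 ?ler_norm.
  by rewrite ler_wpM2l // ler_expR lerN2 ler_wpM2r ?sqr_ge0 // ge_min lexx.
apply: le_trans (FL x) _; apply: le_trans (_ : `|L| * expR (- (e * x ^+ 2)) <= _).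
  by rewrite ler_wpM2r ?expR_ge0 ?ler_norm.
by rewrite ler_wpM2l // ler_expR lerN2 ler_wpM2r ?sqr_ge0 // ge_min lexx orbT.
Qed.

(** Half of the exponent pays for the factor x. *)
Lemma gauss_dominatedX h : gauss_dominated h -> gauss_dominated (fun x => x * h x).
Proof.
move=> [K [c [c0 hK]]]; exists (`|K| * (1 + c^-1)), (c / 2); split => [|x].
  by rewrite divr_gt0.
rewrite normrM; apply: le_trans (_ : `|x| * (`|K| * expR (- (c * x ^+ 2))) <= _).
  rewrite ler_wpM2l //; apply: le_trans (hK x) _.
  by rewrite ler_wpM2r ?expR_ge0 ?ler_norm.
rewrite mulrCA -[leRHS]mulrA ler_wpM2l //.
have -> : expR (- (c * x ^+ 2)) = expR (- (c / 2 * x ^+ 2)) * expR (- (c / 2 * x ^+ 2)).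
  by rewrite -expRD; congr expR; field.
rewrite mulrA ler_wpM2r ?expR_ge0 // expRN ler_pdivrMr ?expR_gt0 //.
apply: le_trans (_ : (1 + c^-1) * (1 + c / 2 * x ^+ 2) <= _); last first.
  by rewrite ler_wpM2l ?expR_ge1Dx // addr_ge0 // invr_ge0 ltW.
have -> : (1 + c^-1) * (1 + c / 2 * x ^+ 2) = 1 + c^-1 + c / 2 * x ^+ 2 + x ^+ 2 / 2.
  by field; rewrite gt_eqF.
have : 0 <= c^-1 by rewrite invr_ge0 ltW.
have : 0 <= c / 2 * x ^+ 2 by rewrite mulr_ge0 ?sqr_ge0 // divr_ge0 // ltW.
have : `|x| <= 1 + x ^+ 2 / 2.
  rewrite -real_normK ?num_real //; move: `|x| => y.
  have : 0 <= (y - 1) ^+ 2 by exact: sqr_ge0.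
  by rewrite sqrrB1; lra.
lra.
Qed.

Lemma integral_scale (s : R) (G : R -> R) : 0 < s -> continuous G ->
  (forall x, 0 <= G x) ->
  (\int[mu]_x (G (s * x))%:E = (s^-1)%:E * \int[mu]_x (G x)%:E)%E.
Proof.
move=> s0 cG G0.
have dF : derive1 ( *%R s) = cst s.
  by apply/funext => z; rewrite (derive1Ml s (@derivable_id _ _ z 1)) derive1_id mulr1.
rewrite (@increasing_ge0_integration_by_substitutionT _ ( *%R s) G) //.
- rewrite dF; under [in RHS]eq_integral do rewrite fctE /= EFinM.
  rewrite ge0_integralZr //=; last 3 first.
  + apply/measurable_EFinP; apply: measurableT_comp => //.
      exact: continuous_measurable_fun.
  + by move=> x _; rewrite lee_fin.
  + by rewrite lee_fin ltW.
  by rewrite muleCA -EFinM mulVf ?gt_eqF // mule1.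
- by move=> x y xy; rewrite ltr_pM2l.
- by rewrite dF => x; exact: cst_continuous.
- by rewrite dF; exact: is_cvg_cst.
- by rewrite dF; exact: is_cvg_cst.
- exact: gt0_cvgMrNy.
- exact: gt0_cvgMry.
Qed.

Lemma integral_gauss (c : R) : 0 < c ->
  (\int[mu]_x (expR (- (c * x ^+ 2)))%:E = (Num.sqrt (pi / c))%:E)%E.
Proof.
move=> c0; have s0 : 0 < Num.sqrt c by rewrite sqrtr_gt0.
have := integral_scale s0 (@continuous_gauss_fun R) (@gauss_fun_ge0 R).
rewrite integralT_gauss /gauss_fun.
under eq_integral do rewrite exprMn sqr_sqrtr ?ltW //.
by move=> ->; rewrite -EFinM mulrC sqrtrM ?pi_ge0 // sqrtrV // ltW.
Qed.

Lemma integrable_gauss (c : R) : 0 < c ->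
  mu.-integrable setT (fun x => (expR (- (c * x ^+ 2)))%:E).
Proof.
move=> c0; apply/integrableP; split.
  apply/measurable_EFinP; apply: measurableT_comp => //.
  by apply: measurableT_comp => //; apply: measurable_funM => //.
under eq_integral do rewrite gee0_abs ?lee_fin ?expR_ge0 //.
by rewrite integral_gauss // ltry.
Qed.

Lemma gauss_dominated_integrable h : measurable_fun setT h -> gauss_dominated h ->
  mu.-integrable setT (EFin \o h).
Proof.
move=> mh [K [c [c0 hK]]].
apply: (le_integrable measurableT _ _ (integrableZl measurableT K (integrable_gauss c0))).
  exact/measurable_EFinP.
move=> x _ /=; rewrite lee_fin; apply: le_trans (hK x) _.
exact: ler_norm.
Qed.

Lemma gauss_dominated_cvg0 h : gauss_dominated h ->
  h n%:R @[n --> \oo] --> 0 /\ h (- n%:R) @[n --> \oo] --> 0.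
Proof.
move=> [K [c [c0 hK]]].
have lim0 : K * gauss_fun (Num.sqrt c * n%:R) @[n --> \oo] --> (0 : R).
  rewrite -(mulr0 K); apply: cvgMl_tmp.
  apply: (cvg_comp (fun n : nat => Num.sqrt c * n%:R) _ _ cvg_gauss_fun).
  apply: (cvg_comp (fun n : nat => n%:R) ( *%R (Num.sqrt c)) cvgr_idn).
  by apply: gt0_cvgMry; rewrite // sqrtr_gt0.
have gE x : expR (- (c * x ^+ 2)) = gauss_fun (Num.sqrt c * x).
  by rewrite /gauss_fun exprMn sqr_sqrtr // ltW.
split; apply: norm_cvg0; apply: (squeeze_cvgr _ (cvg_cst 0) lim0); apply: nearW => n /=.
  by rewrite normr_ge0 -gE hK.
by rewrite normr_ge0 -gE -sqrrN hK.
Qed.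

(** Fundamental theorem of calculus on [- n, n], and dominated convergence;
    this is how integrations by parts on the whole line are done below. *)
Lemma Rintegral_derive0 F h : (forall x : R, is_derive x 1 F (h x)) -> continuous h ->
  gauss_dominated F -> gauss_dominated h -> \int[mu]_x h x = 0.
Proof.
move=> dF ch gF gh.
have mh : measurable_fun setT h by exact: continuous_measurable_fun.
have ih := gauss_dominated_integrable mh gh.
pose D (n : nat) : set R := [set` `[- n%:R, n%:R]].
have mD n : measurable (D n) by exact: measurable_itv.
have lim : \int[mu]_x (h \_ (D n)) x @[n --> \oo] --> \int[mu]_x h x.
  have [] := @dominated_convergence _ _ _ mu setT measurableT
    (fun n x => ((h \_ (D n)) x)%:E) (EFin \o h) (fun x => `|h x|%:E).
  - move=> n; apply/measurable_EFinP/(measurable_restrictT _ (mD n)).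
    exact: measurable_funTS.
  - exact/measurable_EFinP.
  - apply/aeW => x _; apply: cvg_near_cst.
    near=> n; rewrite patchE ifT // inE /D /= in_itv /= -ler_norml.
    by near: n; exact: nbhs_infty_ger.
  - by have := integrable_abse ih.
  - apply/aeW => x n _; rewrite lee_fin patchE; case: ifP => // _.
    by rewrite normr0.
  have -> : (\int[mu]_x (EFin \o h) x = (\int[mu]_x h x)%:E)%E.
    by rewrite /Rintegral fineK //; exact: (integrable_fin_num measurableT ih).
  by move=> _ _ /fine_cvgP [].
have val n : (0 < n)%N -> \int[mu]_x (h \_ (D n)) x = F n%:R - F (- n%:R).
  move=> n0; rewrite -Rintegral_mkcond /Rintegral (@continuous_FTC2 _ h F) //.
  - by rewrite -subr_gt0 opprK addr_gt0 // ltr0n.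
  - exact: continuous_subspaceT.
  - have cF : continuous F.
      move=> x; apply: differentiable_continuous; apply/derivable1_diffP.
      by have [] := dF x.
    split.
    + by move=> x _; have [] := dF x.
    + exact/cvg_at_right_filter/cF.
    + exact/cvg_at_left_filter/cF.
  - by move=> x _; rewrite derive1E; have [_ ->] := dF x.
have [F1 F2] := gauss_dominated_cvg0 gF.
apply/esym; apply: (cvg_unique (@Rhausdorff R) _ lim).
have : F n%:R - F (- n%:R) @[n --> \oo] --> 0 - (0 : R) by exact: cvgB.
rewrite subr0; apply: cvg_trans; apply: near_eq_cvg.
by near=> n; rewrite val //; near: n; exists 1%N.
Unshelve. all: by end_near. Qed.

End GaussDominated.

(** * Oscillatory integrals depending on a parameter *)

Section Osc.
Variable R : realType.
Local Notation mu := (@lebesgue_measure R).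
Implicit Types (g p q : R -> R) (s : R).

Lemma normr_cos_le1 (x : R) : `|cos x| <= 1.
Proof. by rewrite ler_norml cos_geN1 cos_le1. Qed.
Lemma normr_sin_le1 (x : R) : `|sin x| <= 1.
Proof. by rewrite ler_norml sin_geN1 sin_le1. Qed.

Lemma measurable_osc g p q s : measurable_fun setT g -> measurable_fun setT p ->
  measurable_fun setT q ->
  measurable_fun setT (fun x => g x * cos (s * p x + q x)).
Proof.
move=> mg mp mq; apply: measurable_funM => //; apply: measurableT_comp.
  by apply: continuous_measurable_fun; exact: continuous_cos.
by apply: measurable_funD => //; apply: measurable_funM.
Qed.

(** The derivative of the integrand in s is bounded by |p g|, whatever s is. *)
Lemma is_derive_cos_integral g p q s : measurable_fun setT g ->
  measurable_fun setT p -> measurable_fun setT q ->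
  gauss_dominated g -> gauss_dominated (fun x => p x * g x) ->
  is_derive s 1 (fun s => \int[mu]_x (g x * cos (s * p x + q x)))
    (- \int[mu]_x (p x * g x * sin (s * p x + q x))).
Proof.
move=> mg mp mq gg gpg.
pose f s x := g x * cos (s * p x + q x).
have df s' x : is_derive s' 1 (f ^~ x) (- (p x * g x * sin (s' * p x + q x))).
  have d1 : is_derive s' 1 (fun s => s * p x + q x) (p x).
    apply: is_derive_eq (is_deriveD (is_deriveM (is_derive_id _ _) (is_derive_cst (p x) _ _))
      (is_derive_cst (q x) _ _)) _.
    by rewrite scaler0 add0r addr0 /GRing.scale /= mulr1.
  apply: is_derive_eq (is_deriveM (is_derive_cst (g x) s' 1) (is_derive1_comp (is_derive_cos _)
    d1)) _.
  by rewrite scaler0 addr0 /GRing.scale /=; ring.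
have pd s' x : partial1of2 f s' x = - (p x * g x * sin (s' * p x + q x)).
  by rewrite partial1of2E; have [_ ->] := df s' x.
have If s' : mu.-integrable setT (EFin \o f s').
  apply: gauss_dominated_integrable; first exact: measurable_osc.
  by apply: gauss_dominatedM => // x; exact: normr_cos_le1.
have Ia : [set` `]s - 1, s + 1[] s by rewrite /= in_itv /=; lra.
have IG : mu.-integrable setT (EFin \o (fun x => `|p x * g x|)).
  apply: gauss_dominated_integrable.
    by apply: measurableT_comp => //; apply: measurable_funM.
  by have [K [c [c0 h]]] := gpg; exists K, c; split => // x; rewrite normr_id.
have G0 y : 0 <= `|p y * g y| by [].
have Gub x y : [set` `]s - 1, s + 1[] x -> setT y -> `|partial1of2 f x y| <= `|p y * g y|.
  move=> _ _; rewrite pd normrN normrM -[leRHS]mulr1 ler_wpM2l //; exact: normr_sin_le1.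
have dv x y : [set` `]s - 1, s + 1[] x -> setT y -> derivable (f ^~ y) x 1.
  by move=> _ _; have [] := df x y.
apply: DeriveDef.
  exact: (derivable_under_integral measurableT Ia (fun x _ => If x) dv G0 IG Gub).
rewrite -derive1E (differentiation_under_integral measurableT Ia (fun x _ => If x) dv G0 IG Gub).
under eq_Rintegral do rewrite pd -mulN1r.
rewrite RintegralZl // ?mulN1r //.
apply: gauss_dominated_integrable.
  apply: measurable_funM; first exact: measurable_funM.
  apply: measurableT_comp; first by apply: continuous_measurable_fun; exact: continuous_sin.
  by apply: measurable_funD => //; apply: measurable_funM.
by apply: gauss_dominatedM => // x; exact: normr_sin_le1.
Qed.

(** The previous lemma for the phase q - pi / 2. *)
Lemma is_derive_sin_integral g p q s : measurable_fun setT g ->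
  measurable_fun setT p -> measurable_fun setT q ->
  gauss_dominated g -> gauss_dominated (fun x => p x * g x) ->
  is_derive s 1 (fun s => \int[mu]_x (g x * sin (s * p x + q x)))
    (\int[mu]_x (p x * g x * cos (s * p x + q x))).
Proof.
move=> mg mp mq gg gpg.
have mq' : measurable_fun setT (fun x => q x - pi / 2).
  by apply: measurable_funB => //.
have cosE x t : cos (t * p x + (q x - pi / 2)) = sin (t * p x + q x).
  by rewrite addrA cosB cos_pihalf sin_pihalf mulr0 add0r mulr1.
have sinE x t : sin (t * p x + (q x - pi / 2)) = - cos (t * p x + q x).
  by rewrite addrA sinB cos_pihalf sin_pihalf mulr0 sub0r mulr1.
have := is_derive_cos_integral s mg mp mq' gg gpg.
under [X in is_derive _ _ X _]funext do under eq_Rintegral do rewrite cosE.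
under eq_Rintegral do rewrite sinE mulrN -mulN1r.
rewrite RintegralZl // ?mulN1r ?opprK //.
apply: gauss_dominated_integrable.
  apply: (measurable_osc s (g := fun x => p x * g x)) => //.
  exact: measurable_funM.
by apply: gauss_dominatedM => // x; exact: normr_cos_le1.
Qed.

End Osc.

(** * Moments of the complex Gaussian on the line *)

Section Gauss.
Variable R : realType.
Variable a : R.
Hypothesis a0 : 0 < a.
Local Notation mu := (@lebesgue_measure R).

(** The integrand exp (- pi (a + i b) x^2 - 2 i pi eta x) is
    bell 0 x * (cos (phase b eta x) - i sin (phase b eta x)). Real and imaginary
    parts are kept apart so that the derivatives are those of real functions. *)
Definition phase (b eta x : R) := b * (pi * x ^+ 2) + eta * (2 * pi * x).
Definition bell (k : nat) (x : R) := x ^+ k * expR (- (pi * a * x ^+ 2)).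
Definition cos_moment (k : nat) (b eta : R) := \int[mu]_x (bell k x * cos (phase b eta x)).
Definition sin_moment (k : nat) (b eta : R) := \int[mu]_x (bell k x * sin (phase b eta x)).

Lemma continuous_phase b eta : continuous (phase b eta).
Proof.
move=> x; apply: cvgD; apply: cvgMl_tmp; apply: cvgMl_tmp => //.
exact: exprn_continuous.
Qed.

Lemma continuous_bell k : continuous (bell k).
Proof.
move=> x; apply: cvgM; first exact: exprn_continuous.
apply: (@continuous_comp _ _ _ (fun x : R => - (pi * a * x ^+ 2)) expR).
  by apply: cvgN; apply: cvgMl_tmp; exact: exprn_continuous.
exact: continuous_expR.
Qed.

Lemma continuous_bell_cos k b eta : continuous (fun x => bell k x * cos (phase b eta x)).
Proof.
move=> x; apply: cvgM; first exact: continuous_bell.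
apply: (@continuous_comp _ _ _ (phase b eta) cos); first exact: continuous_phase.
exact: continuous_cos.
Qed.

Lemma continuous_bell_sin k b eta : continuous (fun x => bell k x * sin (phase b eta x)).
Proof.
move=> x; apply: cvgM; first exact: continuous_bell.
apply: (@continuous_comp _ _ _ (phase b eta) sin); first exact: continuous_phase.
exact: continuous_sin.
Qed.

Lemma bell_dominated k : gauss_dominated (bell k).
Proof.
elim: k => [|k IH].
  have -> : bell 0 = fun x => expR (- (pi * a * x ^+ 2)).
    by apply/funext => x; rewrite /bell mul1r.
  exact: gauss_dominated_expR (mulr_gt0 (pi_gt0 R) a0).
have -> : bell k.+1 = fun x => x * bell k x.
  by apply/funext => x; rewrite /bell exprS mulrA.
exact: gauss_dominatedX.
Qed.

Lemma bell_cos_dominated k b eta : gauss_dominated (fun x => bell k x * cos (phase b eta x)).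
Proof. by apply: gauss_dominatedM => [|x]; [exact: bell_dominated|exact: normr_cos_le1]. Qed.

Lemma bell_sin_dominated k b eta : gauss_dominated (fun x => bell k x * sin (phase b eta x)).
Proof. by apply: gauss_dominatedM => [|x]; [exact: bell_dominated|exact: normr_sin_le1]. Qed.

Lemma bell_cos_integrable k b eta :
  mu.-integrable setT (EFin \o (fun x => bell k x * cos (phase b eta x))).
Proof.
apply: gauss_dominated_integrable; last exact: bell_cos_dominated.
by apply: continuous_measurable_fun; exact: continuous_bell_cos.
Qed.

Lemma bell_sin_integrable k b eta :
  mu.-integrable setT (EFin \o (fun x => bell k x * sin (phase b eta x))).
Proof.
apply: gauss_dominated_integrable; last exact: bell_sin_dominated.
by apply: continuous_measurable_fun; exact: continuous_bell_sin.
Qed.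

Lemma is_derive_phase b eta (x : R) :
  is_derive x 1 (phase b eta) (2 * pi * (b * x + eta)).
Proof.
apply: is_derive_eq (is_deriveD (is_deriveZ b (is_deriveZ pi (is_deriveX 2 (is_derive_id x 1))))
  (is_deriveZ eta (is_deriveZ (2 * pi) (is_derive_id x 1)))) _.
by rewrite /GRing.scale /= expr1; ring.
Qed.

Lemma is_derive_bell k (x : R) :
  is_derive x 1 (bell k) (k%:R * bell k.-1 x - 2 * pi * a * bell k.+1 x).
Proof.
have d1 : is_derive x 1 (fun x : R => - (pi * a * x ^+ 2)) (- (2 * pi * a * x)).
  apply: is_derive_eq (is_deriveN (is_deriveZ (pi * a) (is_deriveX 2 (is_derive_id x 1)))) _.
  by rewrite /GRing.scale /= expr1; ring.
have -> : bell k = (id ^+ k) * (expR \o (fun x : R => - (pi * a * x ^+ 2))).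
  by apply/funext => y; rewrite /bell exprfctE.
apply: is_derive_eq (is_deriveM (is_deriveX k (is_derive_id x 1))
  (is_derive1_comp (is_derive_expR _) d1)) _.
by rewrite /bell /GRing.scale exprfctE /= [x ^+ k.+1]exprS; ring.
Qed.

Lemma is_derive_bell_cos k b eta (x : R) :
  is_derive x 1 (fun x => bell k x * cos (phase b eta x))
   (k%:R * (bell k.-1 x * cos (phase b eta x))
     - 2 * pi * (a * (bell k.+1 x * cos (phase b eta x)) + b * (bell k.+1 x * sin (phase b eta x))
     + eta * (bell k x * sin (phase b eta x)))).
Proof.
apply: is_derive_eq (is_deriveM (is_derive_bell k x)
  (is_derive1_comp (is_derive_cos _) (is_derive_phase b eta x))) _.
by rewrite /GRing.scale /= /bell [x ^+ k.+1]exprS; ring.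
Qed.

Lemma is_derive_bell_sin k b eta (x : R) :
  is_derive x 1 (fun x => bell k x * sin (phase b eta x))
   (k%:R * (bell k.-1 x * sin (phase b eta x))
     - 2 * pi * (a * (bell k.+1 x * sin (phase b eta x)) - b * (bell k.+1 x * cos (phase b eta x))
     - eta * (bell k x * cos (phase b eta x)))).
Proof.
apply: is_derive_eq (is_deriveM (is_derive_bell k x)
  (is_derive1_comp (is_derive_sin _) (is_derive_phase b eta x))) _.
by rewrite /GRing.scale /= /bell [x ^+ k.+1]exprS; ring.
Qed.

Lemma Rintegral_lin4 (f1 f2 f3 f4 : R -> R) (c1 c2 c3 c4 : R) :
  mu.-integrable setT (EFin \o f1) -> mu.-integrable setT (EFin \o f2) ->
  mu.-integrable setT (EFin \o f3) -> mu.-integrable setT (EFin \o f4) ->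
  \int[mu]_x (c1 * f1 x + c2 * f2 x + c3 * f3 x + c4 * f4 x) =
  c1 * \int[mu]_x f1 x + c2 * \int[mu]_x f2 x + c3 * \int[mu]_x f3 x + c4 * \int[mu]_x f4 x.
Proof.
move=> i1 i2 i3 i4.
have iZ (c : R) f : mu.-integrable setT (EFin \o f) ->
    mu.-integrable setT (EFin \o (fun x => c * f x)).
  by move=> ifi; exact: (integrableZl measurableT c ifi).
have iD (f g : R -> R) : mu.-integrable setT (EFin \o f) -> mu.-integrable setT (EFin \o g) ->
    mu.-integrable setT (EFin \o (fun x => f x + g x)).
  by move=> ifi igi; exact: (integrableD measurableT ifi igi).
have z1 := iZ c1 _ i1; have z2 := iZ c2 _ i2; have z3 := iZ c3 _ i3; have z4 := iZ c4 _ i4.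
have s2 := iD _ _ z1 z2; have s3 := iD _ _ s2 z3.
by rewrite (RintegralD measurableT s3 z4) (RintegralD measurableT s2 z3) (RintegralD measurableT
  z1 z2) !RintegralZl.
Qed.

(** The derivative of x^k times the integrand has integral 0; this is the real
    part, and the next lemma the imaginary part. *)
Lemma moment_ibpC k b eta :
  k%:R * cos_moment k.-1 b eta =
  2 * pi * (a * cos_moment k.+1 b eta + b * sin_moment k.+1 b eta + eta * sin_moment k b eta).
Proof.
apply/eqP; rewrite -subr_eq0; apply/eqP.
have := Rintegral_derive0 (is_derive_bell_cos k b eta).
pose h x := k%:R * (bell k.-1 x * cos (phase b eta x))
  + (- (2 * pi * a)) * (bell k.+1 x * cos (phase b eta x))
  + (- (2 * pi * b)) * (bell k.+1 x * sin (phase b eta x))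
  + (- (2 * pi * eta)) * (bell k x * sin (phase b eta x)).
rewrite (_ : (fun x => k%:R * _ - _) = h); last by apply/funext => x; rewrite /h; ring.
move=> /(_ _ (bell_cos_dominated _ _ _)) h0.
rewrite -[RHS]h0.
- rewrite /h Rintegral_lin4; [|exact: bell_cos_integrable|exact: bell_cos_integrable
    |exact: bell_sin_integrable|exact: bell_sin_integrable].
  by rewrite /cos_moment /sin_moment; ring.
- move=> x; do ?[apply: cvgD]; apply: cvgMl_tmp;
  first [exact: continuous_bell_cos|exact: continuous_bell_sin].
- by do ?[apply: gauss_dominatedD]; apply: gauss_dominatedZ;
  first [exact: bell_cos_dominated|exact: bell_sin_dominated].
Qed.

Lemma moment_ibpS k b eta :
  k%:R * sin_moment k.-1 b eta =
  2 * pi * (a * sin_moment k.+1 b eta - b * cos_moment k.+1 b eta - eta * cos_moment k b eta).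
Proof.
apply/eqP; rewrite -subr_eq0; apply/eqP.
have := Rintegral_derive0 (is_derive_bell_sin k b eta).
pose h x := k%:R * (bell k.-1 x * sin (phase b eta x))
  + (- (2 * pi * a)) * (bell k.+1 x * sin (phase b eta x))
  + (2 * pi * b) * (bell k.+1 x * cos (phase b eta x))
  + (2 * pi * eta) * (bell k x * cos (phase b eta x)).
rewrite (_ : (fun x => k%:R * _ - _) = h); last by apply/funext => x; rewrite /h; ring.
move=> /(_ _ (bell_sin_dominated _ _ _)) h0.
rewrite -[RHS]h0.
- rewrite /h Rintegral_lin4; [|exact: bell_sin_integrable|exact: bell_sin_integrable
    |exact: bell_cos_integrable|exact: bell_cos_integrable].
  by rewrite /cos_moment /sin_moment; ring.
- move=> x; do ?[apply: cvgD]; apply: cvgMl_tmp;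
  first [exact: continuous_bell_cos|exact: continuous_bell_sin].
- by do ?[apply: gauss_dominatedD]; apply: gauss_dominatedZ;
  first [exact: bell_cos_dominated|exact: bell_sin_dominated].
Qed.

End Gauss.

(** * Evaluation of the complex Gaussian integral *)

Section GaussODE.
Variable R : realType.
Variable a : R.
Hypothesis a0 : 0 < a.
Local Notation mu := (@lebesgue_measure R).
Local Notation C := (cos_moment a).
Local Notation S := (sin_moment a).

Lemma measurable_bell k : measurable_fun setT (bell a k).
Proof. by apply: continuous_measurable_fun; exact: continuous_bell. Qed.

Lemma is_derive_cos_moment_b k (b eta : R) :
  is_derive b 1 (fun b => C k b eta) (- (pi * S k.+2 b eta)).
Proof.
have pb x : pi * x ^+ 2 * bell a k x = pi * bell a k.+2 x.
  by rewrite /bell !exprS; ring.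
have h := @is_derive_cos_integral R (bell a k) (fun x => pi * x ^+ 2)
  (fun x => eta * (2 * pi * x)) b.
apply: is_derive_eq (h _ _ _ _ _) _.
- exact: measurable_bell.
- by apply: measurable_funM => //; exact: exprn_measurable.
- by apply: measurable_funM => //; exact: measurable_funM.
- exact: bell_dominated.
- under eq_fun do rewrite pb; apply: gauss_dominatedZ; exact: bell_dominated.
under eq_Rintegral do rewrite pb -mulrA.
by rewrite RintegralZl //; exact: bell_sin_integrable.
Qed.

Lemma is_derive_sin_moment_b k (b eta : R) :
  is_derive b 1 (fun b => S k b eta) (pi * C k.+2 b eta).
Proof.
have pb x : pi * x ^+ 2 * bell a k x = pi * bell a k.+2 x.
  by rewrite /bell !exprS; ring.
have h := @is_derive_sin_integral R (bell a k) (fun x => pi * x ^+ 2)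
  (fun x => eta * (2 * pi * x)) b.
apply: is_derive_eq (h _ _ _ _ _) _.
- exact: measurable_bell.
- by apply: measurable_funM => //; exact: exprn_measurable.
- by apply: measurable_funM => //; exact: measurable_funM.
- exact: bell_dominated.
- under eq_fun do rewrite pb; apply: gauss_dominatedZ; exact: bell_dominated.
under eq_Rintegral do rewrite pb -mulrA.
by rewrite RintegralZl //; exact: bell_cos_integrable.
Qed.

Lemma is_derive_cos_moment_eta k (b eta : R) :
  is_derive eta 1 (C k b) (- (2 * pi * S k.+1 b eta)).
Proof.
have pb x : 2 * pi * x * bell a k x = 2 * pi * bell a k.+1 x.
  by rewrite /bell !exprS; ring.
have h := @is_derive_cos_integral R (bell a k) (fun x => 2 * pi * x) (fun x => b * (pi * x ^+ 2))
  eta.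
have -> : C k b = fun eta => \int[mu]_x (bell a k x * cos (eta * (2 * pi * x) + b * (pi * x ^+ 2))).
  by apply/funext => e; apply: eq_Rintegral => x _; rewrite /phase addrC.
apply: is_derive_eq (h _ _ _ _ _) _.
- exact: measurable_bell.
- by apply: measurable_funM.
- by apply: measurable_funM => //; apply: measurable_funM => //; exact: exprn_measurable.
- exact: bell_dominated.
- under eq_fun do rewrite pb; apply: gauss_dominatedZ; exact: bell_dominated.
under eq_Rintegral do rewrite pb -(mulrA (2 * pi)) addrC.
by rewrite RintegralZl //; exact: bell_sin_integrable.
Qed.

Lemma is_derive_sin_moment_eta k (b eta : R) :
  is_derive eta 1 (S k b) (2 * pi * C k.+1 b eta).
Proof.
have pb x : 2 * pi * x * bell a k x = 2 * pi * bell a k.+1 x.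
  by rewrite /bell !exprS; ring.
have h := @is_derive_sin_integral R (bell a k) (fun x => 2 * pi * x) (fun x => b * (pi * x ^+ 2))
  eta.
have -> : S k b = fun eta => \int[mu]_x (bell a k x * sin (eta * (2 * pi * x) + b * (pi * x ^+ 2))).
  by apply/funext => e; apply: eq_Rintegral => x _; rewrite /phase addrC.
apply: is_derive_eq (h _ _ _ _ _) _.
- exact: measurable_bell.
- by apply: measurable_funM.
- by apply: measurable_funM => //; apply: measurable_funM => //; exact: exprn_measurable.
- exact: bell_dominated.
- under eq_fun do rewrite pb; apply: gauss_dominatedZ; exact: bell_dominated.
under eq_Rintegral do rewrite pb -(mulrA (2 * pi)) addrC.
by rewrite RintegralZl //; exact: bell_cos_integrable.
Qed.

Lemma moment_origin : C 0 0 0 = Num.sqrt a^-1 /\ S 0 0 0 = 0.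
Proof.
have ph x : phase 0 0 x = 0 :> R by rewrite /phase !mul0r addr0.
rewrite /cos_moment /sin_moment; split.
  under eq_Rintegral do rewrite ph cos0 mulr1 /bell mul1r.
  rewrite /Rintegral integral_gauss ?mulr_gt0 ?pi_gt0 //=.
  by rewrite invfM mulrA divff ?mul1r // gt_eqF ?pi_gt0.
under eq_Rintegral do rewrite ph sin0 mulr0.
by rewrite Rintegral_cst // mul0r.
Qed.

(** With C - i S the integral of exp (- pi (a + i b) x^2), this says that
    (a + i b) (C - i S)^2 = 1. The derivative of the left-hand side in b is 0,
    because integration by parts expresses the second moment, which is the
    derivative of C - i S up to a factor, by C - i S itself. At b = 0 this is
    the real Gaussian integral. *)
Lemma moment0_sqr (b : R) :
  a * (C 0 b 0 ^+ 2 - S 0 b 0 ^+ 2) + 2 * b * (C 0 b 0 * S 0 b 0) = 1 /\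
  b * (C 0 b 0 ^+ 2 - S 0 b 0 ^+ 2) - 2 * a * (C 0 b 0 * S 0 b 0) = 0.
Proof.
have ibpC t := moment_ibpC a0 1 t 0.
have ibpS t := moment_ibpS a0 1 t 0.
have dC t := is_derive_cos_moment_b 0 t 0.
have dS t := is_derive_sin_moment_b 0 t 0.
have [C00 S00] := moment_origin.
have sq : Num.sqrt a^-1 ^+ 2 = a^-1 by rewrite sqr_sqrtr // invr_ge0 ltW.
split.
  pose U t := a * (C 0 t 0 * C 0 t 0 - S 0 t 0 * S 0 t 0) + (2 * t) * (C 0 t 0 * S 0 t 0).
  have dU (t : R) : is_derive t 1 U 0.
    apply: is_derive_eq (is_deriveD (is_deriveZ a (is_deriveB (is_deriveM (dC t) (dC t))
      (is_deriveM (dS t) (dS t))))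
      (is_deriveM (is_deriveZ 2 (is_derive_id t 1)) (is_deriveM (dC t) (dS t)))) _.
    rewrite !fctE /= /GRing.scale /=; have := ibpC t; have := ibpS t;
      rewrite /= !mul1r !mul0r addr0 subr0 => -> ->.
    ring.
  transitivity (U b); first by rewrite /U; ring.
  rewrite (is_derive_0_is_cst b 0 dU) /U C00 S00.
  transitivity (a * Num.sqrt a^-1 ^+ 2); first by ring.
  by rewrite sq divff // gt_eqF.
pose U t := t * (C 0 t 0 * C 0 t 0 - S 0 t 0 * S 0 t 0) - (2 * a) * (C 0 t 0 * S 0 t 0).
have dU (t : R) : is_derive t 1 U 0.
  apply: is_derive_eq (is_deriveB (is_deriveM (is_derive_id t 1) (is_deriveB (is_deriveM (dC t)
    (dC t)) (is_deriveM (dS t) (dS t))))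
    (is_deriveZ (2 * a) (is_deriveM (dC t) (dS t)))) _.
  rewrite !fctE /= /GRing.scale /=; have := ibpC t; have := ibpS t;
    rewrite /= !mul1r !mul0r addr0 subr0 => -> ->.
  ring.
transitivity (U b); first by rewrite /U; ring.
by rewrite (is_derive_0_is_cst b 0 dU) /U S00; ring.
Qed.

(** This says that (C - i S) (eta) * exp (pi eta^2 / (a + i b)) does not depend
    on eta: by integration by parts, the derivative of C - i S is
    - 2 pi eta / (a + i b) times C - i S. *)
Lemma moment_eta (b eta : R) : let X := pi * eta ^+ 2 / (a ^+ 2 + b ^+ 2) in
  expR (a * X) * (C 0 b eta * cos (b * X) - S 0 b eta * sin (b * X)) = C 0 b 0 /\
  expR (a * X) * (C 0 b eta * sin (b * X) + S 0 b eta * cos (b * X)) = S 0 b 0.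
Proof.
move=> X.
pose r := a ^+ 2 + b ^+ 2.
have r0 : 0 < r by rewrite ltr_wpDr ?sqr_ge0 // exprn_gt0.
pose dX t := 2 * pi * t / r.
have [S1E C1E] : (forall t, S 1 b t = t * (a * C 0 b t - b * S 0 b t) / r) /\
    (forall t, C 1 b t = - (t * (a * S 0 b t + b * C 0 b t) / r)).
  have ibp t : a * S 1 b t - b * C 1 b t - t * C 0 b t = 0 /\
      a * C 1 b t + b * S 1 b t + t * S 0 b t = 0.
    have cancel2pi (u : R) : 0 = 2 * pi * u -> u = 0.
      by move=> /esym/eqP; rewrite !mulf_eq0 pnatr_eq0 (gt_eqF (pi_gt0 R)) => /eqP.
    by split; apply: cancel2pi; rewrite -?(moment_ibpC a0) -?(moment_ibpS a0) mul0r.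
  split=> t; have [e1 e2] := ibp t; apply: (mulIf (lt0r_neq0 r0)).
    rewrite divfK ?gt_eqF //; apply/eqP; rewrite -subr_eq0; apply/eqP.
    rewrite (_ : _ - _ = a * (a * S 1 b t - b * C 1 b t - t * C 0 b t)
      + b * (a * C 1 b t + b * S 1 b t + t * S 0 b t)); last by rewrite /r; ring.
    by rewrite e1 e2; ring.
  rewrite mulNr divfK ?gt_eqF //; apply/eqP; rewrite -subr_eq0; apply/eqP.
  rewrite (_ : _ - _ = a * (a * C 1 b t + b * S 1 b t + t * S 0 b t)
    - b * (a * S 1 b t - b * C 1 b t - t * C 0 b t)); last by rewrite /r; ring.
  by rewrite e1 e2; ring.
have dC (t : R) : is_derive t 1 (C 0 b) (- (dX t * (a * C 0 b t - b * S 0 b t))).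
  by apply: is_derive_eq (is_derive_cos_moment_eta 0 b t) _; rewrite S1E /dX; ring.
have dS (t : R) : is_derive t 1 (S 0 b) (- (dX t * (a * S 0 b t + b * C 0 b t))).
  by apply: is_derive_eq (is_derive_sin_moment_eta 0 b t) _; rewrite C1E /dX; ring.
pose Y (t : R) := pi / r * t ^+ 2.
have dY (k t : R) : is_derive t 1 (fun t => k * Y t) (k * dX t).
  apply: is_derive_eq (is_deriveZ k (is_deriveZ (pi / r) (is_deriveX 2 (is_derive_id t 1)))) _.
  by rewrite /dX /GRing.scale /= expr1; ring.
have dE (t : R) := is_derive1_comp (is_derive_expR _) (dY a t).
have dcos (t : R) := is_derive1_comp (is_derive_cos _) (dY b t).
have dsin (t : R) := is_derive1_comp (is_derive_sin _) (dY b t).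
have XE : X = Y eta by rewrite /X /Y mulrAC.
have Y0 : Y 0 = 0 by rewrite /Y expr0n mulr0.
rewrite XE; split.
  pose U t := expR (a * Y t) * (C 0 b t * cos (b * Y t) - S 0 b t * sin (b * Y t)).
  have dU (t : R) : is_derive t 1 U 0.
    apply: is_derive_eq (is_deriveM (dE t) (is_deriveB (is_deriveM (dC t) (dcos t))
      (is_deriveM (dS t) (dsin t)))) _.
    by rewrite !fctE /= /GRing.scale /= ; ring.
  have := is_derive_0_is_cst eta 0 dU; rewrite /U Y0 !mulr0 cos0 sin0 expR0 => ->; ring.
pose U t := expR (a * Y t) * (C 0 b t * sin (b * Y t) + S 0 b t * cos (b * Y t)).
have dU (t : R) : is_derive t 1 U 0.
  apply: is_derive_eq (is_deriveM (dE t) (is_deriveD (is_deriveM (dC t) (dsin t))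
    (is_deriveM (dS t) (dcos t)))) _.
  by rewrite !fctE /= /GRing.scale /= ; ring.
have := is_derive_0_is_cst eta 0 dU; rewrite /U Y0 !mulr0 cos0 sin0 expR0 => ->; ring.
Qed.

(** The second moment of exp (- pi w x^2) is 1 / (2 pi w) times its integral,
    for w = a + i b. *)
Lemma moment2E (b : R) : let r := a ^+ 2 + b ^+ 2 in
  2 * pi * r * C 2 b 0 = a * C 0 b 0 - b * S 0 b 0 /\
  2 * pi * r * S 2 b 0 = b * C 0 b 0 + a * S 0 b 0.
Proof.
have := moment_ibpC a0 1 b 0; have := moment_ibpS a0 1 b 0.
by rewrite /= !mul1r !mul0r addr0 subr0 => -> ->; split; ring.
Qed.

End GaussODE.

(** * Complex-valued integrals *)

Local Open Scope complex_scope.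

Section Cint.
Context d (T : measurableType d) (R : realType).
Variable mu : {measure set T -> \bar R}.
Implicit Types f g : T -> R[i].
Local Notation Re := complex.Re.
Local Notation Im := complex.Im.

Definition Cintegrable f :=
  mu.-integrable setT (fun x => (Re (f x))%:E) /\
  mu.-integrable setT (fun x => (Im (f x))%:E).

Definition Cint f : R[i] := (\int[mu]_x Re (f x)) +i* (\int[mu]_x Im (f x)).

Lemma cReM (z w : R[i]) : Re (z * w) = Re z * Re w - Im z * Im w.
Proof. by case: z; case: w. Qed.
Lemma cImM (z w : R[i]) : Im (z * w) = Re z * Im w + Im z * Re w.
Proof. by case: z => a b; case: w. Qed.
Lemma cReD (z w : R[i]) : Re (z + w) = Re z + Re w.
Proof. by case: z; case: w. Qed.
Lemma cImD (z w : R[i]) : Im (z + w) = Im z + Im w.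
Proof. by case: z; case: w. Qed.

Lemma integrable_lin (a b : R) (u v : T -> R) :
  mu.-integrable setT (EFin \o u) -> mu.-integrable setT (EFin \o v) ->
  mu.-integrable setT (fun x => (a * u x + b * v x)%:E).
Proof.
move=> iu iv.
exact: (integrableD measurableT (integrableZl measurableT a iu) (integrableZl measurableT b iv)).
Qed.

Lemma Rintegral_lin (a b : R) (u v : T -> R) :
  mu.-integrable setT (EFin \o u) -> mu.-integrable setT (EFin \o v) ->
  \int[mu]_x (a * u x + b * v x) = a * \int[mu]_x u x + b * \int[mu]_x v x.
Proof.
move=> iu iv; rewrite RintegralD //; last 2 first.
- exact: (integrableZl measurableT a iu).
- exact: (integrableZl measurableT b iv).
by rewrite !RintegralZl.
Qed.

Lemma CintegrableZ c f : Cintegrable f -> Cintegrable (fun x => c * f x).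
Proof.
move=> [fr fi]; split.
  under eq_fun do rewrite cReM -mulNr; exact: integrable_lin.
under eq_fun do rewrite cImM; exact: integrable_lin.
Qed.

Lemma CintZ c f : Cintegrable f -> Cint (fun x => c * f x) = c * Cint f.
Proof.
move=> [fr fi]; rewrite /Cint; apply/eqP; rewrite eq_complex cReM cImM /=; apply/andP; split.
  by under eq_Rintegral do rewrite cReM -mulNr; rewrite Rintegral_lin // mulNr.
by under eq_Rintegral do rewrite cImM; rewrite Rintegral_lin.
Qed.

Lemma CintegrableD f g : Cintegrable f -> Cintegrable g ->
  Cintegrable (fun x => f x + g x).
Proof.
move=> [fr fi] [gr gi]; split.
  under eq_fun do rewrite cReD; exact: (integrableD measurableT fr gr).
under eq_fun do rewrite cImD; exact: (integrableD measurableT fi gi).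
Qed.

Lemma CintD f g : Cintegrable f -> Cintegrable g ->
  Cint (fun x => f x + g x) = Cint f + Cint g.
Proof.
move=> [fr fi] [gr gi]; rewrite /Cint; apply/eqP; rewrite eq_complex cReD cImD /=; apply/andP;
  split.
  by under eq_Rintegral do rewrite cReD; rewrite RintegralD.
by under eq_Rintegral do rewrite cImD; rewrite RintegralD.
Qed.

Lemma Cintegrable0 : Cintegrable (fun=> 0).
Proof. by split; exact: integrable0. Qed.

Lemma Cint0 : Cint (fun=> 0) = 0.
Proof. by rewrite /Cint /= !Rintegral_cst // mul0r. Qed.

Lemma Cintegrable_sum (I : Type) (r : seq I) (F : I -> T -> R[i]) :
  (forall i, Cintegrable (F i)) ->
  Cintegrable (fun x => \sum_(i <- r) F i x).
Proof.
move=> iF; elim: r => [|i r IH].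
  under eq_fun do rewrite big_nil; exact: Cintegrable0.
under eq_fun do rewrite big_cons; exact: CintegrableD.
Qed.

Lemma Cint_sum (I : Type) (r : seq I) (F : I -> T -> R[i]) :
  (forall i, Cintegrable (F i)) ->
  Cint (fun x => \sum_(i <- r) F i x) = \sum_(i <- r) Cint (F i).
Proof.
move=> iF; elim: r => [|i r IH].
  by under [X in Cint X]eq_fun do rewrite big_nil; rewrite Cint0 big_nil.
under [X in Cint X]eq_fun do rewrite big_cons.
by rewrite CintD // ?IH ?big_cons //; exact: Cintegrable_sum.
Qed.

End Cint.

Section Product.
Context d1 d2 (T1 : measurableType d1) (T2 : measurableType d2) (R : realType).
Variables (m1 : {sigma_finite_measure set T1 -> \bar R})
          (m2 : {sigma_finite_measure set T2 -> \bar R}).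

Lemma integrable_prod (f : T1 -> R) (g : T2 -> R) :
  m1.-integrable setT (EFin \o f) -> m2.-integrable setT (EFin \o g) ->
  (m1 \x m2)%E.-integrable setT (fun x => (f x.1 * g x.2)%:E) /\
  \int[(m1 \x m2)%E]_x (f x.1 * g x.2) = (\int[m1]_x f x) * (\int[m2]_x g x).
Proof.
move=> fi gi.
have mf : measurable_fun setT f by move/integrableP: fi => [/measurable_EFinP].
have mg : measurable_fun setT g by move/integrableP: gi => [/measurable_EFinP].
have mfg : measurable_fun setT (fun x : T1 * T2 => (f x.1 * g x.2)%:E).
  by apply/measurable_EFinP; apply: measurable_funM; apply: measurableT_comp.
have ifg : (m1 \x m2)%E.-integrable setT (fun x => (f x.1 * g x.2)%:E).
  apply/(integrable12ltyP m1 m2 mfg).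
  under eq_integral => x _.
    under eq_integral do rewrite /= normrM EFinM.
    rewrite ge0_integralZl //=; last by apply/measurable_EFinP; apply: measurableT_comp.
    over.
  rewrite ge0_integralZr //=; last 2 first.
  - by apply/measurable_EFinP; apply: measurableT_comp.
  - by apply: integral_ge0.
  by apply: lte_mul_pinfty; [exact: integral_ge0| |];
    move/integrableP: fi gi => [_ fi] /integrableP [_ gi] //;
    rewrite ge0_fin_numE //; exact: integral_ge0.
split => //.
rewrite /Rintegral -(integral12_prod_meas1 ifg).
have fg : (\int[m1]_x f x * \int[m2]_x g x)%R%:E = (\int[m1]_x \int[m2]_y (f x * g y)%:E)%E.
  under [RHS]eq_integral => x _.
    under eq_integral do rewrite EFinM.
    rewrite integralZl //.
    over.
  rewrite -(fineK (integrable_fin_num measurableT gi)) /= integralZr //.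
  by rewrite EFinM -[in RHS](fineK (integrable_fin_num measurableT fi)).
by rewrite -fg.
Qed.

Lemma Cintegrable_prod (f : T1 -> R[i]) (g : T2 -> R[i]) :
  Cintegrable m1 f -> Cintegrable m2 g ->
  Cintegrable (m1 \x m2)%E (fun x => f x.1 * g x.2) /\
  Cint (m1 \x m2)%E (fun x => f x.1 * g x.2) = Cint m1 f * Cint m2 g.
Proof.
move=> [fr fi] [gr gi].
have [i1 e1] := integrable_prod fr gr; have [i2 e2] := integrable_prod fi gi.
have [i3 e3] := integrable_prod fr gi; have [i4 e4] := integrable_prod fi gr.
split.
  split.
    by under eq_fun do rewrite cReM; exact: (integrableB measurableT i1 i2).
  by under eq_fun do rewrite cImM; exact: (integrableD measurableT i3 i4).
apply/eqP; rewrite eq_complex cReM cImM /= -e1 -e2 -e3 -e4; apply/andP; split; apply/eqP.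
  rewrite [LHS](eq_Rintegral _ (g := fun x => complex.Re (f x.1) * complex.Re (g x.2) -
    complex.Im (f x.1) * complex.Im (g x.2))).
    by rewrite RintegralB.
  by move=> x _; rewrite cReM.
rewrite [LHS](eq_Rintegral _ (g := fun x => complex.Re (f x.1) * complex.Im (g x.2) + complex.Im
  (f x.1) * complex.Re (g x.2))).
  by rewrite RintegralD.
by move=> x _; rewrite cImM.
Qed.

End Product.

(** * Complex Gaussians on the plane *)

Section ComplexExp.
Variable R : realType.
Local Notation Re := complex.Re.
Local Notation Im := complex.Im.
Implicit Types z w s : R[i].

Definition cexp z : R[i] := (expR (Re z) * cos (Im z)) +i* (expR (Re z) * sin (Im z)).

Lemma cexpD z w : cexp (z + w) = cexp z * cexp w.
Proof.
rewrite /cexp; case: z => a b; case: w => c e /=.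
by apply/eqP; rewrite eq_complex /= expRD cosD sinD; apply/andP; split; apply/eqP; ring.
Qed.

Lemma cexp0 : cexp 0 = 1.
Proof. by rewrite /cexp /= expR0 cos0 sin0 !mul1r. Qed.

Lemma cexp_expi (t : R) : cexp (0 +i* t) = expi t.
Proof. by rewrite /cexp /= expR0 !mul1r. Qed.

Lemma conj_cexp z : conjc (cexp z) = cexp (conjc z).
Proof. by rewrite /cexp; case: z => a b /=; rewrite cosN sinN mulrN. Qed.

Lemma cmodE z : cmod z = Num.sqrt (Re z ^+ 2 + Im z ^+ 2).
Proof. by case: z. Qed.

Lemma cmodM z w : cmod (z * w) = cmod z * cmod w.
Proof. by rewrite /cmod normrM; case: z => a b; case: w => c e /=; rewrite !mul0r subr0. Qed.

Lemma cmod_cexp z : cmod (cexp z) = expR (Re z).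
Proof.
rewrite cmodE /cexp /= !exprMn -mulrDr cos2Dsin2 mulr1 sqrtr_sqr.
by rewrite ger0_norm ?expR_ge0.
Qed.

Lemma cmod_ge0 z : 0 <= cmod z. Proof. by rewrite cmodE sqrtr_ge0. Qed.

Lemma cmod_sqr z : cmod z ^+ 2 = Re (z * conjc z).
Proof.
rewrite cmodE sqr_sqrtr ?addr_ge0 ?sqr_ge0 //.
by case: z => a b /=; ring.
Qed.

Lemma cmodC z : (cmod z)%:C = `|z|.
Proof. by case: z. Qed.

Lemma cmodD z w : cmod (z + w) <= cmod z + cmod w.
Proof.
have := ler_normD z w; rewrite -!cmodC -rmorphD /=.
by rewrite lecR.
Qed.

Lemma cmod_sum (I : Type) (r : seq I) (F : I -> R[i]) :
  cmod (\sum_(i <- r) F i) <= \sum_(i <- r) cmod (F i).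
Proof.
elim: r => [|i r IH]; first by rewrite !big_nil cmodE /= expr0n /= addr0 sqrtr0.
by rewrite !big_cons; apply: le_trans (cmodD _ _) _; rewrite lerD2l.
Qed.

End ComplexExp.

Section Gauss2.
Variable R : realType.
Local Notation mu := (@lebesgue_measure R).
Local Notation Re := complex.Re.
Local Notation Im := complex.Im.
Implicit Types z w s : R[i].

Definition gauss1 w (eta x : R) : R[i] :=
  cexp (- ((pi * x ^+ 2)%:C * w) - (0 +i* (2 * pi * eta * x))).

Definition gauss2 w (x : plane R) : R[i] := cexp (- ((pi * dot2 x x)%:C * w)).

Definition gauss1_int w eta : R[i] :=
  cos_moment (Re w) 0 (Im w) eta -i* sin_moment (Re w) 0 (Im w) eta.

Lemma gauss1E w eta x (k : nat) : (x ^+ k)%:C * gauss1 w eta x =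
  (bell (Re w) k x * cos (phase (Im w) eta x)) -i* (bell (Re w) k x * sin (phase (Im w) eta x)).
Proof.
case: w => a b; rewrite /gauss1 /cexp /=.
have -> : - (pi * x ^+ 2 * a - 0 * b) - 0 = - (pi * a * x ^+ 2) by ring.
have -> : - (pi * x ^+ 2 * b + 0 * a) - 2 * pi * eta * x = - phase b eta x.
  by rewrite /phase; ring.
rewrite cosN sinN /bell.
by apply/eqP; rewrite eq_complex /=; apply/andP; split; apply/eqP; ring.
Qed.

Lemma gauss1_integrable w eta k : 0 < Re w ->
  Cintegrable mu (fun x => (x ^+ k)%:C * gauss1 w eta x).
Proof.
move=> w0; split; under eq_fun do rewrite gauss1E /=.
  exact: bell_cos_integrable.
have := integrableZl measurableT (-1) (bell_sin_integrable w0 k (Im w) eta).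
by apply: eq_integrable => // x _ /=; rewrite -EFinM mulN1r.
Qed.

Lemma Cint_gauss1X w eta k : 0 < Re w ->
  Cint mu (fun x => (x ^+ k)%:C * gauss1 w eta x) =
  cos_moment (Re w) k (Im w) eta -i* sin_moment (Re w) k (Im w) eta.
Proof.
move=> w0; rewrite /Cint; congr (_ +i* _).
  by apply: eq_Rintegral => x _; rewrite gauss1E.
under eq_Rintegral => x _ do rewrite gauss1E [Im _]/= -mulN1r.
by rewrite RintegralZl ?mulN1r //; exact: bell_sin_integrable.
Qed.

Lemma Re_gt0_neq0 w : 0 < Re w -> w != 0.
Proof. by case: w => a b /= a0; rewrite eq_complex /= negb_and gt_eqF. Qed.

(** The square determines the integral over the plane, and avoids a choice of
    branch for the square root of 1 / w. *)
Lemma gauss1_int_sqr w : 0 < Re w -> gauss1_int w 0 ^+ 2 = w^-1.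
Proof.
move=> w0; have w1 := Re_gt0_neq0 w0.
apply: (mulfI w1); rewrite divff //.
case: w w0 {w1} => a b /= a0; rewrite /gauss1_int /=.
have [e1 e2] := moment0_sqr a0 b.
set C := cos_moment _ _ _ _ in e1 e2 *; set S := sin_moment _ _ _ _ in e1 e2 *.
apply/eqP; rewrite eq_complex; apply/andP; split; apply/eqP.
  by rewrite -[RHS]e1 /=; ring.
by rewrite -[RHS]e2 /=; ring.
Qed.

Lemma invc_gauss (a b : R) (t : R) : 0 < a ->
  t%:C * (a +i* b)^-1 = (a * (t / (a ^+ 2 + b ^+ 2))) -i* (b * (t / (a ^+ 2 + b ^+ 2))).
Proof.
move=> a0; have r0 : a ^+ 2 + b ^+ 2 != 0.
  by rewrite gt_eqF // ltr_wpDr ?sqr_ge0 // exprn_gt0.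
have w1 : (a +i* b) != 0 by exact: Re_gt0_neq0.
apply: (mulIf w1); rewrite divfK //.
apply/eqP; rewrite eq_complex /=; apply/andP; split; apply/eqP; field => //.
Qed.

Lemma gauss1_int_eta w eta : 0 < Re w ->
  gauss1_int w eta = gauss1_int w 0 * cexp (- ((pi * eta ^+ 2)%:C * w^-1)).
Proof.
case: w => a b /= a0; rewrite (invc_gauss b _ a0).
set X := _ / _.
have [e1 e2] := moment_eta a0 b eta; rewrite -/X in e1 e2.
have <- : gauss1_int (a +i* b) eta * cexp ((a * X) -i* (b * X)) = gauss1_int (a +i* b) 0.
  rewrite /gauss1_int /= -e1 -e2 /cexp /= cosN sinN.
  by apply/eqP; rewrite eq_complex /=; apply/andP; split; apply/eqP; ring.
by rewrite -mulrA -cexpD subrr cexp0 mulr1.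
Qed.

Lemma gauss2_shift w (x xi : plane R) :
  gauss2 w x * expi (- (2 * pi * dot2 x xi)) = gauss1 w xi.1 x.1 * gauss1 w xi.2 x.2.
Proof.
rewrite /gauss2 /gauss1 -cexp_expi -!cexpD; congr cexp.
case: w => a b; rewrite /dot2; case: x => x1 x2; case: xi => y1 y2 /=.
by apply/eqP; rewrite eq_complex /=; apply/andP; split; apply/eqP; ring.
Qed.

Lemma Cint_gauss1 w eta : 0 < Re w ->
  Cintegrable mu (gauss1 w eta) /\ Cint mu (gauss1 w eta) = gauss1_int w eta.
Proof.
move=> w0; have := gauss1_integrable eta 0 w0; have := Cint_gauss1X eta 0 w0.
by under [X in Cint _ X = _ -> Cintegrable _ X -> _]eq_fun do rewrite expr0 mul1r.
Qed.

(** The integral over the plane is a product of two integrals over the line.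
    Each of them is the value at eta = 0 times an exponential, and the square
    of the value at eta = 0 is 1 / w. *)
Lemma fourier_gauss2 w (xi : plane R) : 0 < Re w ->
  Cintegrable (lebesgue2 R) (fun x => gauss2 w x * expi (- (2 * pi * dot2 x xi))) /\
  fourier (gauss2 w) xi = w^-1 * gauss2 w^-1 xi.
Proof.
move=> w0; have [i1 e1] := Cint_gauss1 xi.1 w0; have [i2 e2] := Cint_gauss1 xi.2 w0.
have [i3 e3] := Cintegrable_prod i1 i2.
have E : (fun x => gauss2 w x * expi (- (2 * pi * dot2 x xi))) =
         (fun x : plane R => gauss1 w xi.1 x.1 * gauss1 w xi.2 x.2).
  by apply/funext => x; rewrite gauss2_shift.
rewrite /fourier E; split; first exact: i3.
transitivity (Cint (lebesgue2 R) (fun x : plane R => gauss1 w xi.1 x.1 * gauss1 w xi.2 x.2)) => //.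
rewrite e3 e1 e2 (gauss1_int_eta xi.1) // (gauss1_int_eta xi.2) //.
rewrite mulrACA -expr2 gauss1_int_sqr // -cexpD /gauss2; congr (_ * cexp _).
by rewrite -opprD -mulrDl -rmorphD /= -mulrDr /dot2 !expr2.
Qed.

(** The weight is a product too, and each factor adds to the integral over the
    line ep times the second moment. *)
Lemma Cint_gauss2_weight s (ep : R) : 0 < Re s ->
  let W (x : plane R) := (1 + ep * x.1 ^+ 2) * (1 + ep * x.2 ^+ 2) in
  Cintegrable (lebesgue2 R) (fun x => (W x)%:C * gauss2 s x) /\
  Cint (lebesgue2 R) (fun x => (W x)%:C * gauss2 s x) =
  s^-1 * (1 + ep%:C / (2 * pi%:C * s)) ^+ 2.
Proof.
move=> s0 W; have s1 := Re_gt0_neq0 s0.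
pose h (x : R) := (1 + ep * x ^+ 2)%:C * gauss1 s 0 x.
have hE : h = fun x => (x ^+ 0)%:C * gauss1 s 0 x + ep%:C * ((x ^+ 2)%:C * gauss1 s 0 x).
  by apply/funext => x; rewrite /h expr0 mul1r mulrA -rmorphM /= rmorphD /= mulrDl mul1r.
have i0 := gauss1_integrable 0 0 s0; have i2 := gauss1_integrable 0 2 s0.
have ih : Cintegrable mu h by rewrite hE; apply: CintegrableD => //; exact: CintegrableZ.
have eh : Cint mu h = gauss1_int s 0 * (1 + ep%:C / (2 * pi%:C * s)).
  rewrite hE CintD //; last exact: CintegrableZ.
  rewrite CintZ // !Cint_gauss1X //.
  rewrite mulrDr mulr1; congr (_ + _); rewrite mulrCA; congr (_ * _).
  have p0 : 2 * pi%:C * s != 0.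
    rewrite mulf_neq0 // mulf_neq0 ?pnatr_eq0 //.
    by rewrite eq_complex /= eqxx andbT gt_eqF ?pi_gt0.
  apply: (mulIf p0); rewrite divfK //.
  case: s s0 s1 {h hE i0 i2 ih p0} => a b /= a0 _; rewrite /gauss1_int /=.
  have [] := moment2E a0 b.
  have := moment_ibpC a0 1 b 0; have := moment_ibpS a0 1 b 0.
  rewrite /= !mul1r !mul0r addr0 subr0 => eS eC _ _.
  apply/eqP; rewrite eq_complex /= eS eC; apply/andP; split; apply/eqP; ring.
have [i3 e3] := Cintegrable_prod ih ih.
have E : (fun x => (W x)%:C * gauss2 s x) = (fun x : plane R => h x.1 * h x.2).
  apply/funext => x; rewrite /h mulrACA -rmorphM /= /W; congr (_ * _).
  rewrite /gauss1 !mulr0 !mul0r -cexpD /gauss2; congr cexp.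
  case: s {s0 s1 h hE i0 i2 ih eh i3 e3} => a b; rewrite /dot2.
  by apply/eqP; rewrite eq_complex /=; apply/andP; split; apply/eqP; ring.
rewrite E; split; first exact: i3.
transitivity (Cint mu h * Cint mu h); first exact: e3.
by rewrite eh mulrACA -!expr2 gauss1_int_sqr.
Qed.

End Gauss2.

(** * Mixtures of Gaussians and their weighted norms *)

Section Mixture.
Variable R : realType.
Local Notation mu := (@lebesgue_measure R).
Local Notation Re := complex.Re.
Local Notation Im := complex.Im.
Implicit Types z w s : R[i].

Lemma integral_oneDsqrV : (\int[mu]_x ((oneDsqr x)^-1)%:E = (pi : R)%:E)%E.
Proof.
rewrite ge0_symfun_integralT.
- rewrite (_ : [set x : R | 0 <= x] = [set` `[0, +oo[]); last first.
    by apply/seteqP; split => x /=; rewrite in_itv /= andbT.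
  have := @integral0y_oneDsqr R; rewrite /Rintegral => e.
  have h : (\int[mu]_(x in [set` `[0%R, +oo[]) ((oneDsqr x)^-1)%:E = (pi / 2)%:E)%E.
    exact: e.
  by rewrite h -EFinM mulrCA divff ?mulr1.
- by move=> x; rewrite invr_ge0 (le_trans ler01) // oneDsqr_ge1.
- exact: continuous_oneDsqrV.
- by move=> x /=; rewrite /oneDsqr sqrrN.
Qed.

Lemma integral_weight1 (ep : R) : 0 < ep ->
  mu.-integrable setT (EFin \o (fun x => (1 + ep * x ^+ 2)^-1)) /\
  \int[mu]_x (1 + ep * x ^+ 2)^-1 = pi / Num.sqrt ep.
Proof.
move=> ep0; have s0 : 0 < Num.sqrt ep by rewrite sqrtr_gt0.
have E x : (1 + ep * x ^+ 2)^-1 = (oneDsqr (Num.sqrt ep * x))^-1.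
  by rewrite /oneDsqr exprMn sqr_sqrtr // ltW.
have G0 x : 0 <= (oneDsqr x)^-1 :> R by rewrite invr_ge0 (le_trans ler01) // oneDsqr_ge1.
have := integral_scale s0 (@continuous_oneDsqrV R) G0.
rewrite integral_oneDsqrV -EFinM mulrC => h.
have me : measurable_fun setT (fun x : R => (1 + ep * x ^+ 2)^-1).
  under eq_fun do rewrite E.
  apply: (measurableT_comp (f := fun x : R => (oneDsqr x)^-1)).
    by apply: continuous_measurable_fun; exact: continuous_oneDsqrV.
  exact: mulrl_measurable.
split; last by rewrite /Rintegral; under eq_integral do rewrite E; rewrite h.
apply/integrableP; split; first exact/measurable_EFinP.
under eq_integral do rewrite /= E ger0_norm //.
by rewrite h ltry.
Qed.

(** A product rather than a function of |x|, so that weighted integrals of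
    Gaussians reduce to moments on the line; quadratic in each variable, so that
    its inverse is integrable. *)
Definition weight2 (ep : R) (x : plane R) : R := (1 + ep * x.1 ^+ 2) * (1 + ep * x.2 ^+ 2).

Lemma weight2_gt0 ep x : 0 < ep -> 0 < weight2 ep x.
Proof.
move=> ep0; have h (t : R) : 0 < 1 + ep * t ^+ 2.
  by rewrite ltr_wpDr // mulr_ge0 ?sqr_ge0 // ltW.
by rewrite mulr_gt0.
Qed.

Lemma integral_weight2V (ep : R) : 0 < ep ->
  (lebesgue2 R).-integrable setT (EFin \o (fun x => (weight2 ep x)^-1)) /\
  \int[lebesgue2 R]_x (weight2 ep x)^-1 = pi ^+ 2 / ep.
Proof.
move=> ep0; have [i1 e1] := integral_weight1 ep0; have [i2 e2] := integrable_prod i1 i1.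
have E : (fun x => (weight2 ep x)^-1) = (fun x => (1 + ep * x.1 ^+ 2)^-1 * (1 + ep * x.2 ^+ 2)^-1).
  by apply/funext => x; rewrite /weight2 invfM.
rewrite E; split; first exact: i2.
transitivity (pi / Num.sqrt ep * (pi / Num.sqrt ep)); first by rewrite -e1 -e2.
by rewrite mulrACA -invfM -!expr2 sqr_sqrtr // ltW.
Qed.

Lemma cmod_le z : cmod z <= `|Re z| + `|Im z|.
Proof.
rewrite cmodE -[leRHS]ger0_norm ?addr_ge0 // -sqrtr_sqr ler_sqrt ?sqr_ge0 //.
rewrite sqrrD !real_normK ?num_real // addrAC lerDl.
by rewrite mulrn_wge0 // mulr_ge0.
Qed.

Lemma cmod_integrable (f : plane R -> R[i]) : Cintegrable (lebesgue2 R) f ->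
  (lebesgue2 R).-integrable setT (EFin \o (fun x => cmod (f x))).
Proof.
move=> [fr fi].
have mr : measurable_fun setT (fun x => Re (f x)) by move/integrableP: fr => [/measurable_EFinP].
have mi : measurable_fun setT (fun x => Im (f x)) by move/integrableP: fi => [/measurable_EFinP].
have := integrableD measurableT (integrable_norm fr) (integrable_norm fi).
apply: le_integrable => //.
  apply/measurable_EFinP; under eq_fun do rewrite cmodE.
  apply: measurableT_comp; first by apply: continuous_measurable_fun; exact: sqrt_continuous.
  by apply: measurable_funD; exact: measurable_funX.
move=> x _ /=; rewrite lee_fin ger0_norm ?cmod_ge0 // ger0_norm ?addr_ge0 //.
exact: cmod_le.
Qed.

(** Integrated form of 2 |f| <= lam W |f|^2 + 1 / (lam W); the best lam gives
    the Cauchy-Schwarz inequality, without its square roots. *)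
Lemma weighted_L1_bound (ep lam : R) (f : plane R -> R[i]) : 0 < ep -> 0 < lam ->
  Cintegrable (lebesgue2 R) f ->
  (lebesgue2 R).-integrable setT (EFin \o (fun x => weight2 ep x * cmod (f x) ^+ 2)) ->
  \int[lebesgue2 R]_x cmod (f x) <=
    (lam * \int[lebesgue2 R]_x (weight2 ep x * cmod (f x) ^+ 2) + lam^-1 * (pi ^+ 2 / ep)) / 2.
Proof.
move=> ep0 lam0 fi wfi; have [wi <-] := integral_weight2V ep0.
rewrite -Rintegral_lin // mulrC -RintegralZl //; last exact: integrable_lin.
apply: le_Rintegral => //; first exact: cmod_integrable.
  exact: (integrableZl measurableT _ (integrable_lin _ _ wfi wi)).
move=> x _; have := weight2_gt0 x ep0.
move: (weight2 ep x) (cmod (f x)) => W c W0.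
have lW : 0 < lam * W by rewrite mulr_gt0.
have : 0 <= (lam * W)^-1 * (lam * W * c - 1) ^+ 2.
  by rewrite mulr_ge0 ?sqr_ge0 // invr_ge0 ltW.
have -> : (lam * W)^-1 * (lam * W * c - 1) ^+ 2 = lam * (W * c ^+ 2) + lam^-1 * W^-1 - 2 * c.
  by field; rewrite !gt_eqF.
lra.
Qed.

Variable I : finType.
Implicit Types (al v : I -> R[i]).

Definition gauss_mixture al v (x : plane R) : R[i] := \sum_i al i * gauss2 (v i) x.

Lemma gauss_mixture_fourier al v xi : (forall i, 0 < Re (v i)) ->
  Cintegrable (lebesgue2 R) (fun x => gauss_mixture al v x * expi (- (2 * pi * dot2 x xi))) /\
  fourier (gauss_mixture al v) xi = \sum_i al i * ((v i)^-1 * gauss2 (v i)^-1 xi).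
Proof.
move=> w0.
have E : (fun x => gauss_mixture al v x * expi (- (2 * pi * dot2 x xi))) =
    fun x => \sum_i al i * (gauss2 (v i) x * expi (- (2 * pi * dot2 x xi))).
  by apply/funext => x; rewrite mulr_suml; apply: eq_bigr => i _; rewrite mulrA.
have gi i := (fourier_gauss2 xi (w0 i)).1.
rewrite /fourier E; split.
  by apply: Cintegrable_sum => i; exact: CintegrableZ.
transitivity (Cint (lebesgue2 R) (fun x => \sum_i al i * (gauss2 (v i) x * expi (- (2 * pi * dot2
  x xi))))) => //.
rewrite Cint_sum; last by move=> i; exact: CintegrableZ.
apply: eq_bigr => i _; rewrite CintZ //; congr (_ * _).
by have [_ <-] := fourier_gauss2 xi (w0 i).
Qed.

Lemma gauss_mixture_integrable al v : (forall i, 0 < Re (v i)) ->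
  Cintegrable (lebesgue2 R) (gauss_mixture al v).
Proof.
move=> w0; have [+ _] := gauss_mixture_fourier al (0, 0) w0.
congr Cintegrable; apply/funext => x.
by rewrite /dot2 /= !mulr0 addr0 mulr0 oppr0 /expi cos0 sin0 mulr1.
Qed.

(** The product of the Gaussian of parameter v i and of the conjugate of that of
    parameter v k is the Gaussian of parameter v i + conj (v k), so the weighted
    square norm is a Hermitian form with an explicit Gram matrix. *)
Lemma gauss_mixture_weighted al v ep : (forall i, 0 < Re (v i)) ->
  (lebesgue2 R).-integrable setT
    (EFin \o (fun x => weight2 ep x * cmod (gauss_mixture al v x) ^+ 2)) /\
  \int[lebesgue2 R]_x (weight2 ep x * cmod (gauss_mixture al v x) ^+ 2) =
  Re (\sum_i \sum_k al i * conjc (al k) * ((v i + conjc (v k))^-1 *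
    (1 + ep%:C / (2 * pi%:C * (v i + conjc (v k)))) ^+ 2)).
Proof.
move=> w0.
have s0 i k : 0 < Re (v i + conjc (v k)).
  by have := w0 i; have := w0 k; rewrite cReD; case: (v k) => a b /= ? ?; rewrite addr_gt0.
pose F x := \sum_i \sum_k al i * conjc (al k) * ((weight2 ep x)%:C * gauss2 (v i + conjc (v k)) x).
have E x : weight2 ep x * cmod (gauss_mixture al v x) ^+ 2 = Re (F x).
  rewrite cmod_sqr.
  have -> : F x = (weight2 ep x)%:C * (gauss_mixture al v x * conjc (gauss_mixture al v x)).
    rewrite /gauss_mixture rmorph_sum /= big_distrlr /= mulr_sumr; apply: eq_bigr => i _.
    rewrite mulr_sumr; apply: eq_bigr => k _.
    have -> : gauss2 (v i + conjc (v k)) x = gauss2 (v i) x * conjc (gauss2 (v k) x).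
      rewrite /gauss2 conj_cexp -cexpD; congr cexp.
      case: (v i) => a b; case: (v k) => c e; apply/eqP.
      by rewrite eq_complex /=; apply/andP; split; apply/eqP; ring.
    have -> : conjc (al k * gauss2 (v k) x) = conjc (al k) * conjc (gauss2 (v k) x).
      exact: rmorphM.
    ring.
  rewrite [RHS]cReM;
    transitivity (weight2 ep x * Re (gauss_mixture al v x * conjc (gauss_mixture al v x))
      - 0 * Im (gauss_mixture al v x * conjc (gauss_mixture al v x))) => //.
  by rewrite mul0r subr0.
have iF : Cintegrable (lebesgue2 R) F.
  apply: Cintegrable_sum => i; apply: Cintegrable_sum => k; apply: CintegrableZ.
  exact: (Cint_gauss2_weight ep (s0 i k)).1.
have EE : (fun x => weight2 ep x * cmod (gauss_mixture al v x) ^+ 2) = (fun x => Re (F x)).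
  by apply/funext => x; rewrite E.
rewrite EE; split; first exact: iF.1.
transitivity (Re (Cint (lebesgue2 R) F)) => //; congr Re.
rewrite Cint_sum; last first.
  move=> i; apply: Cintegrable_sum => k; apply: CintegrableZ.
  exact: (Cint_gauss2_weight ep (s0 i k)).1.
apply: eq_bigr => i _; rewrite Cint_sum; last first.
  move=> k; apply: CintegrableZ.
  exact: (Cint_gauss2_weight ep (s0 i k)).1.
apply: eq_bigr => k _; have [h1 h2] := Cint_gauss2_weight ep (s0 i k).
by rewrite CintZ ?h2.
Qed.

End Mixture.

(** * Fourier analysis on a cyclic group *)

Section DFT.
Variable R : realType.
Local Notation Re := complex.Re.
Local Notation Im := complex.Im.

Lemma expiD (s t : R) : expi (s + t) = expi s * expi t.
Proof. by rewrite -!cexp_expi -cexpD; congr cexp; apply/eqP; rewrite eq_complex /= addr0 !eqxx. Qed.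

Lemma expi0 : expi 0 = 1 :> R[i].
Proof. by rewrite /expi cos0 sin0. Qed.

Lemma conj_expi (t : R) : conjc (expi t) = expi (- t).
Proof. by rewrite /expi cosN sinN. Qed.

Lemma expiX (t : R) n : expi t ^+ n = expi (t * n%:R).
Proof.
elim: n => [|n IH]; first by rewrite expr0 mulr0 expi0.
by rewrite exprS IH -expiD -natr1 mulrDr mulr1 addrC.
Qed.

Lemma expi_2pi n : expi (2 * pi * n%:R) = 1 :> R[i].
Proof.
rewrite -expiX /expi; have -> : 2 * pi = pi *+ 2 :> R by rewrite mulr_natl.
by rewrite cos2pi sin2pi expr1n.
Qed.

Lemma expi_neq1 (t : R) : 0 < t < 2 * pi -> expi t != 1.
Proof.
move=> /andP[t0 t1]; apply/negP => /eqP e.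
have : Re (expi t) = 1 by rewrite e.
rewrite /= (_ : t = (t / 2) *+ 2); last by rewrite -mulr_natr divfK.
rewrite cos_mulr2n => h.
have : 0 < sin (t / 2) by apply: sin_gt0_pi; apply/andP; split; lra.
have := cos2Dsin2 (t / 2).
have -> : cos (t / 2) ^+ 2 = 1 by move: h; rewrite -mulr_natr; lra.
move=> h2; have /eqP : sin (t / 2) ^+ 2 = 0 by lra.
by rewrite sqrf_eq0 => /eqP ->; rewrite ltxx.
Qed.

Variable Q : nat.
Hypothesis Q0 : (0 < Q)%N.

Definition dft_char (j n : nat) : R[i] := expi (2 * pi * (j%:R * n%:R / Q%:R)).

Let QR : Q%:R != 0 :> R.
Proof. by rewrite pnatr_eq0 -lt0n. Qed.

Lemma dft_char_mod j n : dft_char j (n %% Q) = dft_char j n.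
Proof.
rewrite [in RHS](divn_eq n Q) /dft_char natrD natrM.
rewrite -[LHS]mul1r -(expi_2pi (j * (n %/ Q))) -expiD natrM; congr expi.
by field.
Qed.

(** A geometric sum, whose ratio is a Q-th root of unity. *)
Lemma dft_char_orthogonal (m n : 'I_Q) :
  \sum_(j < Q) dft_char j m * conjc (dft_char j n) = (if m == n then Q%:R else 0).
Proof.
pose x : R[i] := expi (2 * pi * ((m%:R - n%:R) / Q%:R)).
have xE (j : nat) : dft_char j m * conjc (dft_char j n) = x ^+ j.
  by rewrite /dft_char conj_expi -expiD /x expiX; congr expi; field.
under eq_bigr do rewrite xE.
have xQ : x ^+ Q = 1.
  rewrite /x expiX (_ : _ * Q%:R = 2 * pi * m%:R - 2 * pi * n%:R); last by field.
  by rewrite expiD -conj_expi !expi_2pi conjc1 mulr1.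
have [mn|mn] := eqVneq m n.
  rewrite (eq_bigr (fun=> 1)) ?sumr_const ?card_ord // => j _.
  by rewrite /x mn subrr mul0r mulr0 expi0 expr1n.
have x1 : x != 1.
  have bd (a b : 'I_Q) : (b < a)%N -> 0 < 2 * (pi : R) * ((a%:R - b%:R) / Q%:R) < 2 * (pi : R).
    move=> ba; have p0 := pi_gt0 R.
    have u0 : 0 < (a%:R - b%:R) / Q%:R :> R by rewrite divr_gt0 ?subr_gt0 ?ltr_nat ?ltr0n.
    have u1 : (a%:R - b%:R) / Q%:R < 1 :> R.
      rewrite ltr_pdivrMr ?ltr0n // mul1r ltrBlDr -natrD ltr_nat.
      by apply: leq_trans (ltn_ord a) _; rewrite leq_addr.
    have tp : (0 : R) < 2 * pi by rewrite mulr_gt0.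
    by apply/andP; split; [exact: mulr_gt0|rewrite gtr_pMr].
  have [lt|lt|/val_inj e] := ltngtP m n; last by rewrite e eqxx in mn.
    have := expi_neq1 (bd _ _ lt); apply: contra => /eqP e; apply/eqP.
    have := conj_expi (2 * pi * ((m%:R - n%:R) / Q%:R)); rewrite -/x e conjc1 => ->.
    by congr expi; field.
  exact: expi_neq1 (bd _ _ lt).
apply: (mulfI (_ : x - 1 != 0)); first by rewrite subr_eq0.
by rewrite -subrX1 xQ subrr mulr0.
Qed.

Variable Z : nat -> bool.
Hypothesis ZQ : forall n, Z (n %% Q) = Z n.

Definition dft (j : nat) : R[i] := Q%:R^-1 * \sum_(m < Q) (Z m)%:R * dft_char j m.

Definition density : R := (\sum_(m < Q) Z m)%N%:R / Q%:R.

Let QC : Q%:R != 0 :> R[i].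
Proof. by rewrite pnatr_eq0 -lt0n. Qed.

Lemma dft_inversion n : \sum_(j < Q) dft j * conjc (dft_char j n) = (Z n)%:R.
Proof.
have [n' n'E] : exists n' : 'I_Q, nat_of_ord n' = (n %% Q)%N.
  by exists (Ordinal (ltn_pmod n Q0)).
transitivity (\sum_(j < Q) \sum_(m < Q) Q%:R^-1 * (Z m)%:R * (dft_char j m * conjc (dft_char j
  n'))).
  apply: eq_bigr => j _; rewrite n'E dft_char_mod /dft mulr_sumr mulr_suml.
  by apply: eq_bigr => m _; rewrite !mulrA.
rewrite exchange_big /=; under eq_bigr do rewrite -mulr_sumr dft_char_orthogonal.
rewrite (bigD1 n') //= eqxx big1 => [|m /negPf ->]; last by rewrite mulr0.
by rewrite addr0 n'E ZQ mulrAC mulVf // mul1r.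
Qed.

Lemma dft_parseval : \sum_(j < Q) cmod (dft j) ^+ 2 = density.
Proof.
have E : \sum_(j < Q) dft j * conjc (dft j) = density%:C.
  transitivity (\sum_(j < Q) \sum_(m < Q) \sum_(n < Q)
      Q%:R^-2 * (Z m)%:R * (Z n)%:R * (dft_char j m * conjc (dft_char j n))).
    apply: eq_bigr => j _; rewrite /dft.
    have cQ (k : nat) : conjc k%:R = k%:R :> R[i] by rewrite rmorph_nat.
    have -> : conjc (Q%:R^-1 * \sum_(m < Q) (Z m)%:R * dft_char j m) =
      Q%:R^-1 * \sum_(m < Q) (Z m)%:R * conjc (dft_char j m).
      transitivity (conjc Q%:R^-1 * \sum_(m < Q) conjc ((Z m)%:R * dft_char j m)).
        by rewrite -rmorph_sum -rmorphM.
      congr (_ * _); first by rewrite -[in RHS]cQ; exact: fmorphV.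
      by apply: eq_bigr => m _; rewrite -[in RHS]cQ; exact: rmorphM.
    rewrite mulrACA -invfM -expr2 big_distrlr /= mulr_sumr; apply: eq_bigr => m _.
    by rewrite mulr_sumr; apply: eq_bigr => n _; ring.
  rewrite exchange_big /=.
  transitivity (\sum_(m < Q) Q%:R^-2 * (Z m)%:R * (Z m)%:R * Q%:R : R[i]).
    apply: eq_bigr => m _; rewrite exchange_big /=.
    under eq_bigr do rewrite -mulr_sumr dft_char_orthogonal.
    rewrite (bigD1 m) //= eqxx big1 ?addr0 // => n nm.
    by rewrite eq_sym (negPf nm) mulr0.
  transitivity (Q%:R^-1 * (\sum_(m < Q) Z m)%N%:R : R[i]).
    rewrite natr_sum mulr_sumr; apply: eq_bigr => m _.
    by case: (Z m); rewrite ?mulr1 ?mulr0 ?mul0r //= expr2 invfM -mulrA mulVf // mulr1.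
  by rewrite /density rmorphM /= fmorphV !rmorph_nat mulrC.
have : Re (\sum_(j < Q) dft j * conjc (dft j)) = density by rewrite E.
by move=> <-; rewrite raddf_sum /=; apply: eq_bigr => j _; rewrite cmod_sqr.
Qed.

Lemma density_ge0 : 0 <= density.
Proof. by rewrite divr_ge0. Qed.

Lemma cmod_dft_char j n : cmod (dft_char j n) = 1.
Proof. by rewrite /dft_char -cexp_expi cmod_cexp expR0. Qed.

Lemma cmod_nat n : cmod n%:R = n%:R :> R.
Proof.
rewrite -(rmorph_nat (real_complex R)) /= cmodE /= expr0n /= addr0 sqrtr_sqr.
by rewrite ger0_norm.
Qed.

Lemma cmodV (z : R[i]) : cmod z^-1 = (cmod z)^-1.
Proof.
apply: (@complexI R); rewrite cmodC normfV -cmodC; exact: esym (fmorphV _ _).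
Qed.

Lemma dft_le1 j : cmod (dft j) <= density.
Proof.
rewrite /dft cmodM cmodV cmod_nat mulrC ler_wpM2r ?invr_ge0 //.
apply: le_trans (cmod_sum _ _) _; rewrite natr_sum; apply: ler_sum => m _.
by rewrite cmodM cmod_dft_char mulr1 cmod_nat.
Qed.

Lemma density_le1 : density <= 1.
Proof.
rewrite ler_pdivrMr ?ltr0n // mul1r ler_nat -[leqRHS]card_ord -sum1_card.
by apply: leq_sum => m _; case: (Z m).
Qed.

End DFT.

(** * The correction term *)

Section Correction.
Variable R : realType.
Local Notation Re := complex.Re.
Local Notation Im := complex.Im.
Variables (Q : nat) (Z : nat -> bool) (ep : R).
Hypothesis Q0 : (0 < Q)%N.
Hypothesis ZQ : forall n, Z (n %% Q) = Z n.
Hypothesis ep0 : 0 < ep.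
Local Notation d := (density R Q Z).
Local Notation c := (dft R Q Z).

(** The z_j of the introduction: multiplying exp (- pi ep t) by the character
    exp (- 2 i pi j t / Q) of the integers t amounts to replacing ep by z_j. *)
Definition freq (j : nat) : R[i] := ep +i* (2 * (j%:R / Q%:R)).
Definition correction (x : plane R) : R[i] :=
  gauss_mixture (fun j : 'I_Q => ep%:C * c j * (freq j)^-1) (fun j : 'I_Q => (freq j)^-1) x.

Let QR : Q%:R != 0 :> R.
Proof. by rewrite pnatr_eq0 -lt0n. Qed.

Lemma Re_inv_gt0 (z : R[i]) : 0 < Re z -> 0 < Re z^-1.
Proof.
case: z => a b a0; have -> : (a +i* b)^-1 = 1%:C * (a +i* b)^-1 by rewrite rmorph1 mul1r.
rewrite (invc_gauss b 1 a0) /=; rewrite /= in a0.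
by rewrite mulr_gt0 // divr_gt0 // ltr_wpDr ?sqr_ge0 // exprn_gt0.
Qed.

Lemma freq_Re j : 0 < Re (freq j). Proof. exact: ep0. Qed.
Lemma freq_neq0 j : freq j != 0. Proof. exact: Re_gt0_neq0 (freq_Re j). Qed.
Lemma freqV_Re j : 0 < Re (freq j)^-1. Proof. exact: Re_inv_gt0 (freq_Re j). Qed.

Lemma gauss2_freq (j n : nat) (xi : plane R) : dot2 xi xi = n%:R ->
  gauss2 (freq j) xi = (expR (- (pi * n%:R * ep)))%:C * conjc (dft_char R Q j n).
Proof.
move=> xin; rewrite /gauss2 xin /freq /dft_char conj_expi -cexp_expi.
have -> : (expR (- (pi * n%:R * ep)))%:C = cexp ((- (pi * n%:R * ep))%:C).
  by rewrite /cexp /= cos0 sin0 mulr1 mulr0.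
rewrite -cexpD; congr cexp; apply/eqP; rewrite eq_complex /=.
by apply/andP; split; apply/eqP; field.
Qed.

(** By inversion on Z / Q, the sum of the c_j against the characters at n is the
    indicator of Z at n. *)
Lemma correction_fourier (n : nat) (xi : plane R) : dot2 xi xi = n%:R ->
  Cintegrable (lebesgue2 R) (fun x => correction x * expi (- (2 * pi * dot2 x xi))) /\
  fourier correction xi = (ep * expR (- (pi * n%:R * ep)))%:C * (Z n)%:R.
Proof.
move=> xin.
have [i1 e1] := gauss_mixture_fourier (fun j : 'I_Q => ep%:C * c j * (freq j)^-1) xi
   (fun j : 'I_Q => freqV_Re j).
split; first exact: i1.
rewrite [LHS]e1 -(dft_inversion R Q0 ZQ) mulr_sumr; apply: eq_bigr => j _.
rewrite invrK (gauss2_freq _ xin) rmorphM /=.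
by rewrite -mulrA [X in _ * X]mulrA mulVf ?freq_neq0 // mul1r; ring.
Qed.

Lemma gauss_fourier (n : nat) (xi : plane R) : dot2 xi xi = n%:R ->
  Cintegrable (lebesgue2 R) (fun x => gauss2 ep^-1%:C x * expi (- (2 * pi * dot2 x xi))) /\
  fourier (gauss2 ep^-1%:C) xi = (ep * expR (- (pi * n%:R * ep)))%:C.
Proof.
move=> xin; have w0 : 0 < Re ep^-1%:C by rewrite /= invr_gt0.
have [i1 e1] := fourier_gauss2 xi w0; split => //; rewrite e1.
have -> : (ep^-1%:C)^-1 = ep%:C by rewrite -fmorphV /= invrK.
rewrite rmorphM /=; congr (_ * _); rewrite /gauss2 xin /cexp /=.
by rewrite !mulr0 mul0r !oppr0 !addr0 oppr0 cos0 sin0 mulr1 mulr0.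
Qed.

Lemma Re_le_cmod (z : R[i]) : `|Re z| <= cmod z.
Proof. by rewrite cmodE -sqrtr_sqr ler_wsqrtr // lerDl sqr_ge0. Qed.
Lemma Im_le_cmod (z : R[i]) : `|Im z| <= cmod z.
Proof. by rewrite cmodE -sqrtr_sqr ler_wsqrtr // lerDr sqr_ge0. Qed.

Lemma cmod_gauss2_le1 w (x : plane R) : 0 < Re w -> cmod (gauss2 w x) <= 1.
Proof.
case: w => a b /= a0; rewrite /gauss2 cmod_cexp /= mul0r subr0 -expR0 ler_expR oppr_le0.
rewrite mulr_ge0 ?(ltW a0) // mulr_ge0 ?pi_ge0 //.
by rewrite /dot2 -!expr2 addr_ge0 ?sqr_ge0.
Qed.

Lemma cmod_conj (z : R[i]) : cmod (conjc z) = cmod z.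
Proof. by rewrite !cmodE; case: z => a b /=; rewrite sqrrN. Qed.

Lemma cmodR (r : R) : cmod r%:C = `|r|.
Proof. by rewrite cmodE /= expr0n /= addr0 sqrtr_sqr. Qed.

Hypothesis epQ : ep * Q%:R ^+ 3 <= d.

Let Q1 : 1 <= Q%:R :> R. Proof. by rewrite ler1n. Qed.
Let d1 : d <= 1. Proof. exact: density_le1. Qed.
Let epQ1 : ep * Q%:R <= 1.
Proof.
apply: le_trans d1; apply: le_trans epQ; rewrite ler_pM2l // exprS ler_peMr ?(le_trans ler01) //.
by rewrite exprn_ege1.
Qed.
Let ep1 : ep <= 1.
Proof. by apply: le_trans epQ1; rewrite ler_peMr // ltW. Qed.

Lemma freq_cmod_ge (j : 'I_Q) : j != 0 :> nat -> 2 / Q%:R <= cmod (freq j).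
Proof.
move=> j0; apply: le_trans (Im_le_cmod _); rewrite /freq /= ger0_norm.
  by rewrite ler_pM2l // ler_peMl ?invr_ge0 // ler1n lt0n.
by rewrite mulr_ge0 // divr_ge0.
Qed.

Lemma freq_cmod_le (j : 'I_Q) : cmod (freq j) <= 3.
Proof.
apply: le_trans (cmod_le _) _; rewrite /freq /= ger0_norm ?(ltW ep0) // ger0_norm; last first.
  by rewrite mulr_ge0 // divr_ge0.
have : j%:R / Q%:R <= 1 :> R by rewrite ler_pdivrMr ?ltr0n // mul1r ler_nat ltnW.
have := ep1; lra.
Qed.

(** The j-th term is at most ep |c_j| / |z_j|. As |z_0| = ep and |c_0| <= d, the
    term j = 0 is at most d. For the others |z_j| >= 2 / Q, so that they are of
    order ep Q, and epQ makes their sum at most d. *)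
Lemma correction_sup x : cmod (correction x) <= 2 * d.
Proof.
apply: le_trans (cmod_sum _ _) _.
apply: le_trans (_ : \sum_(j < Q) (d * (if j == 0 :> nat then 1 else 0) + ep * Q%:R) <= _);
  last first.
  rewrite big_split /= sumr_const card_ord -mulr_sumr -big_mkcond /=.
  rewrite (big_pred1 (Ordinal Q0)) //=.
  rewrite mulr1 (_ : 2 * d = d + d); last by ring.
  rewrite lerD2l; apply: le_trans epQ.
  have -> : ep * Q%:R *+ Q = ep * Q%:R ^+ 2 by rewrite -[LHS]mulr_natr; ring.
  rewrite ler_pM2l //.
  by rewrite [leRHS]exprS ler_peMl // exprn_ge0.
apply: ler_sum => j _; rewrite cmodM.
apply: le_trans (_ : cmod (ep%:C * c j * (freq j)^-1) <= _).
  by rewrite ler_piMr ?cmod_ge0 // cmod_gauss2_le1 // freqV_Re.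
rewrite cmodM (cmodM ep%:C) cmodR (gtr0_norm ep0) (cmodV (freq j)).
have cj := dft_le1 R Q Z j.
case: eqP => [j0|/eqP j0].
  have -> : cmod (freq j) = ep.
    transitivity (cmod ep%:C); last by rewrite cmodR gtr0_norm.
    by rewrite /freq j0 mul0r mulr0.
  by rewrite mulrAC divff ?gt_eqF // mul1r mulr1; apply: le_trans cj _;
    rewrite lerDl mulr_ge0 // ltW.
rewrite mulr0 add0r -mulrA ler_pM2l //.
apply: le_trans (_ : 1 * (2 / Q%:R)^-1 <= _).
  apply: ler_pM; rewrite ?cmod_ge0 ?invr_ge0 ?cmod_ge0 //.
    exact: le_trans cj d1.
  rewrite lef_pV2 ?posrE ?freq_cmod_ge //.
    by apply: lt_le_trans (freq_cmod_ge j0); rewrite divr_gt0 // ltr0n.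
  by rewrite divr_gt0 // ltr0n.
by rewrite mul1r invf_div ler_piMr //; lra.
Qed.

(** With sigma = z_j + conj z_k, the entry of the Gram matrix multiplied by
    z_j^-1 conj (z_k^-1) is
    sigma^-1 (1 + ep z_j conj z_k / (2 pi sigma))^2. The constants come from
    |z_j|, |z_k| <= 3 and 2 pi >= 4. *)
Lemma gram_bound (j k : 'I_Q) (tau : R) : 0 < tau ->
  tau <= cmod (freq j + conjc (freq k)) ->
  cmod ((freq j)^-1 * conjc (freq k)^-1 *
    (((freq j)^-1 + conjc (freq k)^-1)^-1 *
    (1 + ep%:C / (2 * pi%:C * ((freq j)^-1 + conjc (freq k)^-1))) ^+ 2))
  <= tau^-1 * (1 + 9 * ep / (4 * tau)) ^+ 2.
Proof.
move=> tau0 ht; have zj := freq_neq0 j; have zk := freq_neq0 k.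
have zk' : conjc (freq k) != 0 by rewrite conjc_eq0.
set a := freq j in zj ht *; set b := freq k in zk zk' ht *.
have cV : conjc b^-1 = (conjc b)^-1 by exact: fmorphV.
have ab0 : a + conjc b != 0.
  by apply/eqP => e; move: ht; rewrite e cmodR normr0 leNgt tau0.
rewrite cV; have p0 : pi%:C != 0 :> R[i] by rewrite eq_complex /= eqxx andbT gt_eqF ?pi_gt0.
have -> : a^-1 * (conjc b)^-1 * ((a^-1 + (conjc b)^-1)^-1 *
    (1 + ep%:C / (2 * pi%:C * (a^-1 + (conjc b)^-1))) ^+ 2) =
  (a + conjc b)^-1 * (1 + ep%:C * (2 * pi%:C)^-1 * (a * conjc b) * (a + conjc b)^-1) ^+ 2.
  have -> : a^-1 + (conjc b)^-1 = (a + conjc b) / (a * conjc b).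
    by field; rewrite zj zk'.
  move: (pi%:C) p0 => P p0; move: (conjc b) zk' ab0 => b' zk' ab0.
  by field; apply/and4P; split.
rewrite cmodM cmodV expr2 cmodM -expr2.
have sV : (cmod (a + conjc b))^-1 <= tau^-1.
  by rewrite lef_pV2 ?posrE //; exact: lt_le_trans ht.
apply: ler_pM; rewrite ?invr_ge0 ?exprn_ge0 ?cmod_ge0 //.
apply: lerXn2r; rewrite ?nnegrE ?cmod_ge0 //.
  by rewrite addr_ge0 // divr_ge0 ?mulr_ge0 // ltW.
apply: le_trans (cmodD _ _) _; rewrite (cmod_nat R 1 : cmod 1 = 1) lerD2l.
rewrite !cmodM !cmodV !cmodM cmod_conj !cmodR cmod_nat (gtr0_norm ep0) (gtr0_norm (pi_gt0 R)).
have hab : cmod a * cmod b <= 9.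
  have -> : 9 = 3 * 3 :> R by rewrite -natrM.
  by rewrite ler_pM ?cmod_ge0 ?freq_cmod_le.
have hp : (2 * pi)^-1 <= 4^-1 :> R.
  rewrite lef_pV2 ?posrE ?mulr_gt0 ?pi_gt0 //; have := pi_ge2 R; lra.
have -> : 9 * ep / (4 * tau) = ep * 4^-1 * 9 * tau^-1 by field; rewrite gt_eqF.
rewrite ler_pM ?mulr_ge0 ?invr_ge0 ?mulr_ge0 ?cmod_ge0 ?(ltW ep0) ?pi_ge0 //.
rewrite ler_pM ?mulr_ge0 ?invr_ge0 ?mulr_ge0 ?cmod_ge0 ?(ltW ep0) ?pi_ge0 //.
by rewrite ler_pM2l.
Qed.

(** On the diagonal sigma = 2 ep, and the bound of the entry is of order 1 / ep;
    off the diagonal |sigma| >= 2 / Q, and it is of order Q. After the factor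
    ep^2 c_j conj c_k, the diagonal contributes 3 ep d at most by
    Parseval's formula, and the rest 3 ep^2 Q^3 at most, which is bounded by
    the same quantity. *)
Lemma correction_weighted :
  (lebesgue2 R).-integrable setT (EFin \o (fun x => weight2 ep x * cmod (correction x) ^+ 2)) /\
  \int[lebesgue2 R]_x (weight2 ep x * cmod (correction x) ^+ 2) <= 8 * ep * d.
Proof.
have [i1 e1] := gauss_mixture_weighted (fun j : 'I_Q => ep%:C * c j * (freq j)^-1) ep
   (fun j : 'I_Q => freqV_Re j).
split; first exact: i1.
rewrite [leLHS]e1; apply: le_trans (ler_norm _) _; apply: le_trans (Re_le_cmod _) _.
apply: le_trans (_ : \sum_(j < Q) (3 * ep * cmod (c j) ^+ 2 + \sum_(k < Q) 3 * ep ^+ 2 * Q%:R) <=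
  _); last first.
  rewrite big_split /= -mulr_sumr (dft_parseval R Q0).
  rewrite (eq_bigr (fun=> 3 * ep * (ep * Q%:R ^+ 2))); last first.
    by move=> j _; rewrite sumr_const card_ord -[_ *+ Q]mulr_natr; ring.
  rewrite sumr_const card_ord -[_ *+ Q]mulr_natr.
  have -> : 3 * ep * (ep * Q%:R ^+ 2) * Q%:R = 3 * ep * (ep * Q%:R ^+ 3) by ring.
  apply: le_trans (_ : 3 * ep * d + 3 * ep * d <= _).
    by rewrite lerD2l ler_pM2l // mulr_gt0.
  have : 0 <= ep * d by rewrite mulr_ge0 ?density_ge0 // ltW.
  lra.
apply: le_trans (cmod_sum _ _) _; apply: ler_sum => j _.
apply: le_trans (cmod_sum _ _) _.
apply: le_trans (_ : \sum_(k < Q) ((if k == j then 3 * ep * cmod (c j) ^+ 2 else 0) + 3 * ep ^+ 2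
  * Q%:R) <= _); last first.
  by rewrite big_split /= -big_mkcond big_pred1_eq.
apply: ler_sum => k _.
have E : conjc (ep%:C * c k * (freq k)^-1) = ep%:C * conjc (c k) * conjc (freq k)^-1.
  transitivity (conjc ep%:C * conjc (c k) * conjc (freq k)^-1); first by rewrite -!rmorphM.
  by rewrite conjc_real.
rewrite E.
set G := _ * (1 + _) ^+ 2.
have -> : ep%:C * c j * (freq j)^-1 * (ep%:C * conjc (c k) * conjc (freq k)^-1) * G =
  (ep%:C * ep%:C) * (c j * conjc (c k)) * ((freq j)^-1 * conjc (freq k)^-1 * G) by ring.
rewrite cmodM (cmodM (ep%:C * _)) (cmodM ep%:C) (cmodM (c j)) cmod_conj cmodR (gtr0_norm ep0)
  -expr2.
have e2 : 0 < ep ^+ 2 by rewrite exprn_gt0.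
have nn : 0 <= 3 * ep ^+ 2 * Q%:R by rewrite mulr_ge0 // mulr_ge0 // ltW.
case: eqP => [kj|/eqP kj].
  have : cmod ((freq j)^-1 * conjc (freq k)^-1 * G) <= 3 * ep^-1 * 2^-1 * 2.
    apply: le_trans (gram_bound (tau := 2 * ep) _ _) _; first by rewrite mulr_gt0.
      rewrite kj; apply: le_trans (Re_le_cmod _); rewrite /freq /=.
      by apply: le_trans (ler_norm _); lra.
    have -> : 9 * ep / (4 * (2 * ep)) = 9 / 8 by field; rewrite gt_eqF.
    rewrite invfM; have : 0 < ep^-1 by rewrite invr_gt0.
    move: (ep^-1) => t t0; rewrite expr2; lra.
  rewrite kj -expr2 => h.
  apply: le_trans (_ : ep ^+ 2 * cmod (c j) ^+ 2 * (3 * ep^-1 * 2^-1 * 2) <= _).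
    by rewrite ler_wpM2l // mulr_ge0 ?exprn_ge0 ?cmod_ge0 // ltW.
  apply: le_trans (_ : 3 * ep * cmod (c j) ^+ 2 <= _); last by rewrite lerDl.
  by rewrite le_eqVlt; apply/orP; left; apply/eqP; field; rewrite gt_eqF.
rewrite add0r.
have h : cmod ((freq j)^-1 * conjc (freq k)^-1 * G) <= 3 * Q%:R.
  apply: le_trans (gram_bound (tau := 2 / Q%:R) _ _) _; first by rewrite divr_gt0 // ltr0n.
    apply: le_trans (Im_le_cmod _); rewrite /freq /= -mulrBr -mulrBl normrM ger0_norm //.
    rewrite ler_pM2l // normrM [X in _ * X]ger0_norm ?invr_ge0 // ler_peMl ?invr_ge0 //.
    have [lt|lt|/val_inj e] := ltngtP k j; last by rewrite e eqxx in kj.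
      by rewrite -natrB ?(ltnW lt) // ger0_norm // ler1n subn_gt0.
    by rewrite distrC -natrB ?(ltnW lt) // ger0_norm // ler1n subn_gt0.
  have -> : 9 * ep / (4 * (2 / Q%:R)) = 9 / 8 * (ep * Q%:R) by field.
  rewrite invf_div.
  apply: le_trans (_ : Q%:R / 2 * (1 + 9 / 8) ^+ 2 <= _); last by have := Q1; rewrite expr2; lra.
  rewrite ler_wpM2l ?divr_ge0 //; apply: lerXn2r; rewrite ?nnegrE.
  - by rewrite addr_ge0 // mulr_ge0 ?divr_ge0 // mulr_ge0 // ltW.
  - by rewrite addr_ge0 // divr_ge0.
  - by rewrite lerD2l ler_piMr // divr_ge0.
apply: le_trans (_ : ep ^+ 2 * 1 * (3 * Q%:R) <= _); last by rewrite mulr1 mulrCA mulrA.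
apply: ler_pM; rewrite ?cmod_ge0 //.
  by rewrite mulr_ge0 ?(ltW e2) // mulr_ge0 ?cmod_ge0.
rewrite ler_pM2l //.
have c1 (i : 'I_Q) : cmod (c i) <= 1 by exact: le_trans (dft_le1 R Q Z i) d1.
by rewrite -[leRHS]mulr1; apply: ler_pM; rewrite ?cmod_ge0 ?c1.
Qed.

End Correction.

(** * A spike with Fourier transform vanishing on the circles *)

Section Bump.
Variable R : realType.
Local Notation Re := complex.Re.
Local Notation Im := complex.Im.

Definition on_circles (r : plane R) :=
  exists k l : int, norm2 r = Num.sqrt (l%:~R ^+ 2 + k%:~R ^+ 2).

Lemma dot2_ge0 (x : plane R) : 0 <= dot2 x x.
Proof. by rewrite /dot2 -!expr2 addr_ge0 ?sqr_ge0. Qed.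

Lemma on_circles_dot2 (r : plane R) : on_circles r ->
  exists k l : nat, dot2 r r = (k ^ 2 + l ^ 2)%:R.
Proof.
move=> [k [l e]]; exists `|l|%N, `|k|%N.
have sq (z : int) : (z%:~R : R) ^+ 2 = (`|z| ^ 2)%N%:R.
  rewrite natrX -[LHS]real_normK ?num_real //; congr (_ ^+ 2).
  by rewrite -intr_norm -abszE pmulrn.
rewrite natrD -!sq; apply: (pexpIrn (n := 2)) => //.
- by rewrite nnegrE dot2_ge0.
- by rewrite nnegrE addr_ge0 ?sqr_ge0.
have : (norm2 r ^+ 2) ^+ 2 = (Num.sqrt (l%:~R ^+ 2 + k%:~R ^+ 2) ^+ 2) ^+ 2 by rewrite e.
by rewrite /norm2 !sqr_sqrtr ?dot2_ge0 ?addr_ge0 ?sqr_ge0.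
Qed.

Definition bump (ep : R) (e : plane R -> R[i]) (x : plane R) : R[i] :=
  gauss2 ep^-1%:C x + -1 * e x.

(** The density of Z has to be small with respect to del, and ep with respect
    to both the density and the period. *)
Lemma exists_bump (del : R) : 0 < del -> exists (ep : R) (e : plane R -> R[i]),
  [/\ 0 < ep <= del, forall x, cmod (e x) <= del,
      Cintegrable (lebesgue2 R) (bump ep e),
      \int[lebesgue2 R]_x cmod (bump ep e x) <= 2 * del &
      forall r, on_circles r ->
        let h x := bump ep e x * expi (- (2 * pi * dot2 x r)) in
        Cintegrable (lebesgue2 R) h /\ Cint (lebesgue2 R) h = 0].
Proof.
move=> del0.
(* del / 2 serves the supremum, which is at most twice the density; the second
   bound makes 64 d / del <= del / 2 in the estimate of the L^1 norm *)
pose d0 : R := Num.min (del / 2) (del ^+ 2 / 200).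
have d00 : 0 < d0 by rewrite lt_min !divr_gt0 ?exprn_gt0.
have [y hy] := sparse_period d00.
pose Q := period y; pose Z := sieved y.
have Q0 : (0 < Q)%N by exact: period_gt0.
have QR : 0 < Q%:R :> R by rewrite ltr0n.
have ZQ (n : nat) : Z (n %% Q)%N = Z n by exact: sieved_mod.
have dd0 : density R Q Z <= d0 by rewrite ler_pdivrMr.
have dpos : 0 < density R Q Z.
  rewrite divr_gt0 // ltr0n (bigD1 (Ordinal Q0)) //=.
  by rewrite (_ : Z 0%N) //; exact: (sieved_two_squares y 0 0).
set d := density R Q Z in dd0 dpos.
have [d1 d2] : d <= del / 2 /\ d <= del ^+ 2 / 200.
  by move: dd0; rewrite le_min => /andP.
pose ep := Num.min del (d / Q%:R ^+ 3).
have ep0 : 0 < ep by rewrite lt_min del0 divr_gt0 // exprn_gt0.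
have epdel : ep <= del by rewrite ge_min lexx.
have epQ : ep * Q%:R ^+ 3 <= d.
  by rewrite -ler_pdivlMr ?exprn_gt0 // ge_min lexx orbT.
pose e := correction Q Z ep.
have ie : Cintegrable (lebesgue2 R) e.
  by apply: gauss_mixture_integrable => j; exact: freqV_Re.
have w0 : 0 < Re ep^-1%:C by rewrite /= invr_gt0.
have [ig eg] : Cintegrable (lebesgue2 R) (gauss2 ep^-1%:C) /\
   Cint (lebesgue2 R) (gauss2 ep^-1%:C) = ep%:C.
  have [] := Cint_gauss2_weight 0 w0.
  have -> : (fun x : plane R => ((1 + 0 * x.1 ^+ 2) * (1 + 0 * x.2 ^+ 2))%:C * gauss2 ep^-1%:C x)
     = gauss2 ep^-1%:C.
    by apply/funext => x; rewrite !mul0r !addr0 mulr1 mul1r.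
  move=> h ->; split => //.
  by rewrite mul0r addr0 expr1n mulr1 -fmorphV /= invrK.
have ib : Cintegrable (lebesgue2 R) (bump ep e).
  by apply: CintegrableD => //; exact: CintegrableZ.
exists ep, e; split => //.
- by rewrite ep0.
- move=> x; apply: le_trans (correction_sup Q0 ep0 epQ x) _; rewrite -/d; lra.
- apply: le_trans (_ : \int[lebesgue2 R]_x (1 * cmod (gauss2 ep^-1%:C x) + 1 * cmod (e x)) <= _).
    apply: le_Rintegral => //; first exact: cmod_integrable.
      by apply: integrable_lin; exact: cmod_integrable.
    move=> x _; apply: le_trans (cmodD _ _) _; rewrite !mul1r lerD2l cmodM.
    by rewrite !cmodE /= oppr0 expr0n /= addr0 sqrrN expr1n sqrtr1 mul1r.
  rewrite Rintegral_lin ?mul1r; [|exact: cmod_integrable|exact: cmod_integrable].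
  have -> : \int[lebesgue2 R]_x cmod (gauss2 ep^-1%:C x) = ep.
    transitivity (Re (Cint (lebesgue2 R) (gauss2 ep^-1%:C))); last by rewrite eg.
    apply: eq_Rintegral => x _; rewrite /gauss2 cmod_cexp /cexp /=.
    by rewrite !mulr0 mul0r addr0 oppr0 cos0 mulr1.
  rewrite mulr_natl mulr2n lerD //.
  have [i1 h1] := correction_weighted Q0 ep0 epQ.
  have lam0 : 0 < 16 / (del * ep) by rewrite divr_gt0 // mulr_gt0.
  apply: le_trans (weighted_L1_bound ep0 lam0 ie i1) _.
  apply: le_trans (_ : (16 / (del * ep) * (8 * ep * d) + (16 / (del * ep))^-1 * (16 / ep)) / 2 <=
    _).
    rewrite ler_pM2r ?invr_gt0 // lerD //; first by rewrite ler_pM2l.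
    rewrite ler_wpM2l ?invr_ge0 ?(ltW lam0) // ler_pM2r ?invr_gt0 //.
    have := pihalf_lt2 R; have := pi_gt0 R => p0 p1.
    have p2 : pi < 4 :> R by lra.
    have -> : 16 = 4 ^+ 2 :> R by rewrite -natrX.
    by apply: lerXn2r; rewrite ?nnegrE // ltW.
  have -> : (16 / (del * ep) * (8 * ep * d) + (16 / (del * ep))^-1 * (16 / ep)) / 2 =
     64 * d / del + del / 2 by field; rewrite !gt_eqF.
  have : 64 * d / del <= del / 2.
    rewrite ler_pdivrMr // mulrAC -expr2.
    have : 0 <= del ^+ 2 by rewrite sqr_ge0.
    lra.
  lra.
move=> r /on_circles_dot2 [k [l rE]] h.
have [i1 e1] := gauss_fourier ep0 rE; have [i2 e2] := correction_fourier Q0 ZQ ep0 rE.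
have hE : h = fun x => gauss2 ep^-1%:C x * expi (- (2 * pi * dot2 x r))
    + -1 * (e x * expi (- (2 * pi * dot2 x r))).
  by apply/funext => x; rewrite /h /bump mulrDl mulrA.
rewrite hE; split; first by apply: CintegrableD => //; exact: CintegrableZ.
rewrite CintD //; last exact: CintegrableZ.
rewrite CintZ //.
transitivity (fourier (gauss2 ep^-1%:C) r + -1 * fourier e r) => //.
rewrite e1 e2 (_ : Z _) ?mulr1; last exact: sieved_two_squares.
by rewrite mulN1r subrr.
Qed.

End Bump.

(** * Absolutely convergent series of functions *)

Section DominatedSeries.
Context d (T : measurableType d) (R : realType).
Variable mu : {measure set T -> \bar R}.
Variables (a : nat -> T -> R) (B : R).
Hypothesis a_ge0 : forall k x, 0 <= a k x.
Hypothesis a_int : forall k, mu.-integrable setT (EFin \o a k).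
Hypothesis a_bounded : forall n, \sum_(k < n) \int[mu]_x a k x <= B.

Definition dominator (x : T) : \bar R := (\sum_(k <oo) (a k x)%:E)%E.
Definition summable_set : set T := [set x | (dominator x < +oo)%E].

Let ma k : measurable_fun setT (a k).
Proof. by move/integrableP: (a_int k) => [/measurable_EFinP]. Qed.

Let mg : measurable_fun setT dominator.
Proof.
rewrite /dominator; apply: (ge0_emeasurable_sum (P := xpredT)) => [k x _ _|k _].
  by rewrite lee_fin.
exact/measurable_EFinP.
Qed.

Lemma dominator_ge0 x : (0 <= dominator x)%E.
Proof. by apply: nneseries_ge0 => k _ _; rewrite lee_fin. Qed.

Lemma dominator_integrable : mu.-integrable setT dominator.
Proof.
apply/integrableP; split => //.
under eq_integral do rewrite gee0_abs ?dominator_ge0 //.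
rewrite /dominator integral_nneseries //; first last.
- by move=> n x _; rewrite lee_fin.
- by move=> n; exact/measurable_EFinP.
apply: (@le_lt_trans _ _ B%:E); last exact: ltry.
apply: lime_le.
  by apply: is_cvg_nneseries => n _ _; apply: integral_ge0 => x _; rewrite lee_fin.
apply: nearW => n; rewrite big_mkord.
rewrite (eq_bigr (fun k : 'I_n => (\int[mu]_x a k x)%:E)).
  by rewrite sumEFin lee_fin; exact: a_bounded.
move=> k _; rewrite /Rintegral fineK //.
exact: (integrable_fin_num measurableT (a_int k)).
Qed.

Lemma ae_summable : {ae mu, forall x, summable_set x}.
Proof.
have := integrable_ae measurableT dominator_integrable.
apply: filterS => x /(_ I) h.
by rewrite /summable_set /= -ge0_fin_numE // dominator_ge0.
Qed.

Lemma measurable_summable_set : measurable summable_set.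
Proof.
rewrite /summable_set -[X in measurable X]setTI.
exact: measurable_lte.
Qed.

(** Set to 0 where the series need not converge, a null set, so that the limit
    exists everywhere and is measurable. *)
Definition sum_series (v : nat -> T -> R) : T -> R :=
  (fun x => limn (series (v ^~ x))) \_ summable_set.

Lemma dominated_series (v : nat -> T -> R) :
  (forall k, measurable_fun setT (v k)) -> (forall k x, `|v k x| <= a k x) ->
  [/\ mu.-integrable setT (EFin \o sum_series v),
    forall x, summable_set x -> series (v ^~ x) n @[n --> \oo] --> sum_series v x &
    (forall k, \int[mu]_x v k x = 0) -> \int[mu]_x sum_series v x = 0].
Proof.
move=> mv va.
have cv x : summable_set x -> series (v ^~ x) n @[n --> \oo] --> sum_series v x.
  move=> Nx; rewrite /sum_series patchE mem_set //.
  apply: (@normed_cvg R R); apply: (@series_le_cvg _ _ (a ^~ x)) => //.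
  - by move=> n; exact: normr_ge0.
  - by move=> n; exact: va.
  - exact: nnseries_is_cvg.
pose u n := (fun x => series (v ^~ x) n) \_ summable_set.
have ms n : measurable_fun setT (fun x => series (v ^~ x) n).
  by rewrite /series /=; exact: measurable_sum.
have mu_ n : measurable_fun setT (u n).
  apply/(measurable_restrictT _ measurable_summable_set).
  exact: measurable_funTS.
have ucv x : u n x @[n --> \oo] --> sum_series v x.
  rewrite /u; have [Nx|Nx] := pselect (summable_set x).
    apply: cvg_trans (cv x Nx); apply: near_eq_cvg; apply: nearW => n.
    by rewrite patchE mem_set.
  rewrite /sum_series patchE memNset //; apply: cvg_near_cst; apply: nearW => n.
  by rewrite patchE memNset.
have ug n x : (`|(u n x)%:E| <= dominator x)%E.
  rewrite /u patchE; case: ifP => _; last by rewrite abse0 dominator_ge0.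
  apply: le_trans (nneseries_lim_ge (m := 0) n _); last by move=> k _ _; rewrite lee_fin.
  rewrite sumEFin lee_fin /series /=; apply: le_trans (ler_norm_sum _ _ _) _.
  exact: ler_sum.
have mF : measurable_fun setT (sum_series v) by apply: (measurable_fun_cvg mu_) => x _.
have [] := @dominated_convergence _ _ _ mu setT measurableT (fun n x => (u n x)%:E)
   (EFin \o sum_series v) dominator.
- by move=> n; exact/measurable_EFinP.
- exact/measurable_EFinP.
- by apply/aeW => x _; apply: cvg_EFin; [exact: nearW|exact: ucv].
- exact: dominator_integrable.
- exact/aeW.
move=> iF _ lim; split => // v0.
have iv k : mu.-integrable setT (EFin \o v k).
  apply: (le_integrable measurableT _ _ (a_int k)); first exact/measurable_EFinP.
  by move=> x _; rewrite /= lee_fin (ger0_norm (a_ge0 k x)).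
have u0 n : (\int[mu]_x (u n x)%:E = 0)%E.
  transitivity (\int[mu]_x (\sum_(0 <= k < n) v k x)%:E)%E.
    apply: ae_eq_integral => //; [exact/measurable_EFinP|apply/measurable_EFinP; exact: (ms n)|].
    by apply: filterS ae_summable => x Nx _; rewrite /u patchE mem_set.
  under eq_integral do rewrite -sumEFin.
  rewrite integral_sum //; apply: big1_seq => k _.
  transitivity (\int[mu]_x v k x)%:E; last by rewrite v0.
  by rewrite /Rintegral fineK //; exact: (integrable_fin_num measurableT (iv k)).
rewrite /Rintegral; have -> // : (\int[mu]_x (sum_series v x)%:E = 0)%E.
apply: (cvg_unique (@ereal_hausdorff R) lim).
by apply: cvg_near_cst; apply: nearW => n; rewrite /= u0.
Qed.

End DominatedSeries.

(** * Superposition of spikes *)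

Section Final.
Variable R : realType.
Local Notation Re := complex.Re.
Local Notation Im := complex.Im.

Lemma sum_halves (n : nat) : \sum_(k < n) (2^-1 : R) ^+ k.+1 <= 1.
Proof.
suff -> : \sum_(k < n) (2^-1 : R) ^+ k.+1 = 1 - 2^-1 ^+ n by rewrite lerBlDr lerDl exprn_ge0.
elim: n => [|n IH]; first by rewrite big_ord0 expr0 subrr.
by rewrite big_ord_recr /= IH exprS; field.
Qed.

Section ComplexSeries.
Variables (h : nat -> plane R -> R[i]) (B : R).
Hypothesis hi : forall k, Cintegrable (lebesgue2 R) (h k).
Hypothesis hB : forall n, \sum_(k < n) \int[lebesgue2 R]_x cmod (h k x) <= B.

Let a k x := cmod (h k x).
Let a_ge0 k x : 0 <= a k x. Proof. exact: cmod_ge0. Qed.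
Let a_int k : (lebesgue2 R).-integrable setT (EFin \o a k).
Proof. exact: cmod_integrable. Qed.

Definition complex_series (x : plane R) : R[i] :=
  sum_series a (fun k x => Re (h k x)) x +i* sum_series a (fun k x => Im (h k x)) x.

Let mRe k : measurable_fun setT (fun x => Re (h k x)).
Proof. by have [/integrableP[/measurable_EFinP]] := hi k. Qed.
Let mIm k : measurable_fun setT (fun x => Im (h k x)).
Proof. by have [_ /integrableP[/measurable_EFinP]] := hi k. Qed.

Lemma complex_series_integrable : Cintegrable (lebesgue2 R) complex_series.
Proof.
have [i1 _ _] := dominated_series a_ge0 a_int hB mRe (fun k x => Re_le_cmod (h k x)).
have [i2 _ _] := dominated_series a_ge0 a_int hB mIm (fun k x => Im_le_cmod (h k x)).
by split.
Qed.

Lemma complex_series_cvg : {ae lebesgue2 R, forall x, series (fun k => Re (h k x)) n @[n --> \oo]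
  --> Re (complex_series x)}.
Proof.
have [_ c1 _] := dominated_series a_ge0 a_int hB mRe (fun k x => Re_le_cmod (h k x)).
by apply: filterS (ae_summable a_ge0 a_int hB) => x; exact: c1.
Qed.

(** The series multiplied by m is again dominated by the moduli of the h k, and
    its sum is m times the sum of the series. *)
Lemma Cint_complex_series_mul (m : plane R -> R[i]) : (forall x, cmod (m x) <= 1) ->
  (forall k, Cintegrable (lebesgue2 R) (fun x => h k x * m x) /\
     Cint (lebesgue2 R) (fun x => h k x * m x) = 0) ->
  Cint (lebesgue2 R) (fun x => complex_series x * m x) = 0.
Proof.
move=> m1 hm.
have [_ c1 _] := dominated_series a_ge0 a_int hB mRe (fun k x => Re_le_cmod (h k x)).
have [_ c2 _] := dominated_series a_ge0 a_int hB mIm (fun k x => Im_le_cmod (h k x)).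
have hma k x : cmod (h k x * m x) <= a k x by rewrite cmodM ler_piMr ?cmod_ge0.
have mr k : measurable_fun setT (fun x => Re (h k x * m x)).
  by have [[/integrableP[/measurable_EFinP]]] := hm k.
have mi k : measurable_fun setT (fun x => Im (h k x * m x)).
  by have [[_ /integrableP[/measurable_EFinP]]] := hm k.
have [_ c3 z3] := dominated_series a_ge0 a_int hB mr (fun k x => le_trans (Re_le_cmod _) (hma k x)).
have [_ c4 z4] := dominated_series a_ge0 a_int hB mi (fun k x => le_trans (Im_le_cmod _) (hma k x)).
rewrite /Cint; apply/eqP; rewrite eq_complex; apply/andP; split; apply/eqP.
  rewrite [RHS]/= -[RHS]z3; last by move=> k; have [_ /(congr1 (@complex.Re R))] := hm k.
  apply: eq_Rintegral => x _; rewrite cReM.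
  have [Nx|Nx] := pselect (summable_set a x); last first.
    by rewrite /complex_series /sum_series /= !patchE !memNset // !mul0r subr0.
  apply: (cvg_unique (@Rhausdorff R) _ (c3 x Nx)).
  have -> : series (fun k => Re (h k x * m x)) =
    fun n => series (fun k => Re (h k x)) n * Re (m x) - series (fun k => Im (h k x)) n * Im (m x).
    apply/funext => n; rewrite /series /= !mulr_suml -sumrB.
    by apply: eq_bigr => k _; rewrite cReM.
  by apply: cvgB; apply: cvgMr_tmp; [exact: c1|exact: c2].
rewrite [RHS]/= -[RHS]z4; last by move=> k; have [_ /(congr1 (@complex.Im R))] := hm k.
apply: eq_Rintegral => x _; rewrite cImM.
have [Nx|Nx] := pselect (summable_set a x); last first.
  by rewrite /complex_series /sum_series /= !patchE !memNset // !mul0r addr0.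
apply: (cvg_unique (@Rhausdorff R) _ (c4 x Nx)).
have -> : series (fun k => Im (h k x * m x)) =
  fun n => series (fun k => Re (h k x)) n * Im (m x) + series (fun k => Im (h k x)) n * Re (m x).
  apply/funext => n; rewrite /series /= !mulr_suml -big_split.
  by apply: eq_bigr => k _; rewrite cImM.
by apply: cvgD; apply: cvgMr_tmp; [exact: c1|exact: c2].
Qed.

End ComplexSeries.

Definition square (rho : R) : set (plane R) :=
  [set` `]- rho, rho[] `*` [set` `]- rho, rho[].

Lemma measurable_square rho : measurable (square rho).
Proof. by apply: measurableX; exact: measurable_itv. Qed.

Lemma square_gt0 rho : 0 < rho -> (0 < lebesgue2 R (square rho))%E.
Proof.
move=> r0; pose I : set R := [set` `]- rho, rho[].
have -> : (lebesgue2 R (square rho) =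
   lebesgue_measure I * lebesgue_measure I)%E.
  by apply: product_measure1E; exact: measurable_itv.
rewrite /I.
rewrite lebesgue_measure_itv /= lte_fin ifT; last by lra.
by rewrite -EFinD -EFinM lte_fin mulr_gt0 //; lra.
Qed.

Lemma square_dot2 rho (x : plane R) : square rho x -> dot2 x x <= 2 * rho ^+ 2.
Proof.
case: x => x y [/=]; rewrite !in_itv /= /dot2 /=.
move=> /andP[x1 x2] /andP[y1 y2].
have h (t : R) : - rho < t -> t < rho -> t * t <= rho ^+ 2.
  by move=> t1 t2; rewrite -subr_ge0 expr2 (_ : _ - _ = (rho - t) * (rho + t));
    [rewrite mulr_ge0 //; lra|ring].
by have := h _ x1 x2; have := h _ y1 y2; lra.
Qed.

(** A constant bounding |f| almost everywhere on the disc would contradict the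
    hypothesis on a square, which is contained in the disc and is not null. *)
Lemma Linfty_norm_disc_infty (f : plane R -> R[i]) :
  (forall M : R, exists2 rho : R, 0 < rho < 2^-1 &
    {ae lebesgue2 R, forall x, square rho x -> M < cmod (f x)}) ->
  Linfty_norm_disc f = +oo%E.
Proof.
move=> hf; rewrite /Linfty_norm_disc Lnorm.unlock.
have sub (rho : R) : 0 < rho < 2^-1 -> square rho `<=` unit_disc R.
  move=> /andP[r0 r1] x /square_dot2 xr; rewrite /unit_disc /= /norm2.
  rewrite -[ltRHS]sqrtr1 ltr_sqrt //; apply: le_lt_trans xr _.
  by rewrite expr2; nra.
set nu := mrestr _ _.
have nu_pos : (0 < nu setT)%E.
  have [rho rr _] := hf 0; rewrite /nu /mrestr setTI.
  have /andP[r0 _] := rr.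
  apply: lt_le_trans (square_gt0 r0) _; apply: le_measure; rewrite ?inE //.
  - exact: measurable_square.
  - exact: measurable_unit_disc.
  - exact: sub.
rewrite nu_pos; apply/eqP; rewrite -leye_eq leNgt; apply/negP => hlt.
have [M hM] : exists M : R, (ess_sup nu (abse \o (fun x => (cmod (f x))%:E)) <= M%:E)%E.
  move: hlt; case: (ess_sup _ _) => [r _|//|_]; first by exists r.
  by exists 0; exact: leNye.
move/ess_supP: hM => hM.
have [rho rr hrho] := hf M; have /andP[r0 _] := rr.
have [A [mA nA subA]] := hM; have [B [mB nB subB]] := hrho.
have : square rho `<=` (A `&` unit_disc R) `|` B.
  move=> x xs; have [Bx|nBx] := pselect (B x); [by right|left; split; last exact: sub xs].
  apply: subA => /= hx; apply: nBx; apply: subB => /= hx2.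
  have := hx2 xs; move: hx; rewrite lee_fin ger0_norm ?cmod_ge0 // => hx.
  by rewrite ltNge hx.
move=> sAB.
have mAD : measurable (A `&` unit_disc R) by apply: measurableI => //; exact: measurable_unit_disc.
have h1 : (lebesgue2 R (square rho) <= lebesgue2 R ((A `&` unit_disc R) `|` B))%E.
  apply: le_measure; rewrite ?inE //; first exact: measurable_square.
  exact: measurableU.
have h2 : (lebesgue2 R ((A `&` unit_disc R) `|` B) <= 0)%E.
  apply: le_trans (measureU2 _ mAD mB) _.
  have nA' : lebesgue2 R (A `&` unit_disc R) = 0 by exact: nA.
  by rewrite [X in (_ + X)%E]nB adde0 [X in (X <= _)%E]nA'.
by have := lt_le_trans (square_gt0 r0) (le_trans h1 h2); rewrite ltxx.
Qed.

End Final.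

Theorem corollary2 (R : realType) :
  exists2 f : plane R -> complex R, X2 R f & Linfty_norm_disc f = +oo%E.
Proof.
pose del k : R := 2^-1 ^+ k.+1.
have del0 k : 0 < del k by rewrite exprn_gt0 // invr_gt0.
have /choice [p hp] : forall k, exists q : R * (plane R -> R[i]),
  [/\ 0 < q.1 <= del k, forall x, cmod (q.2 x) <= del k,
      Cintegrable (lebesgue2 R) (bump q.1 q.2),
      \int[lebesgue2 R]_x cmod (bump q.1 q.2 x) <= 2 * del k &
      forall r, on_circles r ->
        let h x := bump q.1 q.2 x * expi (- (2 * pi * dot2 x r)) in
        Cintegrable (lebesgue2 R) h /\ Cint (lebesgue2 R) h = 0].
  by move=> k; have [ep [e H]] := exists_bump (del0 k); exists (ep, e).
pose h k := bump (p k).1 (p k).2.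
have hi k : Cintegrable (lebesgue2 R) (h k) by have [_ _ ? _ _] := hp k.
have hB n : \sum_(k < n) \int[lebesgue2 R]_x cmod (h k x) <= 2.
  apply: le_trans (_ : \sum_(k < n) 2 * del k <= _).
    by apply: ler_sum => k _; have [_ _ _ ? _] := hp k.
  by rewrite -mulr_sumr ler_piMr // sum_halves.
have If := complex_series_integrable hi hB.
exists (complex_series h).
  split.
    split.
      by have [/integrableP[/measurable_EFinP ? _] /integrableP[/measurable_EFinP ? _]] := If.
    have /integrableP[_] := cmod_integrable If.
    by under eq_integral do rewrite /= ger0_norm ?cmod_ge0 //.
  move=> r rc; apply: (Cint_complex_series_mul hi hB).
    by move=> x; rewrite -cexp_expi cmod_cexp expR0.
  by move=> k; have [_ _ _ _ /(_ r rc)] := hp k.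
apply: Linfty_norm_disc_infty => M.
pose K := Num.bound (2 * (M + 1)).
have KM : 2 * (M + 1) < K%:R.
  apply: le_lt_trans (ler_norm _) _; have := archi_boundP (normr_ge0 (2 * (M + 1))).
  by rewrite /K /Num.bound normr_id.
have [m m0 mK] : exists2 m : R, 0 < m & forall k, (k < K)%N -> m <= (p k).1.
  elim: (K) => [|n [m m0 IH]]; first by exists 1.
  have [/andP[pn _] _ _ _ _] := hp n.
  exists (Num.min m (p n).1) => [|k]; first by rewrite lt_min m0.
  rewrite ltnS leq_eqVlt => /orP[/eqP ->|kn]; first by rewrite ge_min lexx orbT.
  by rewrite ge_min IH.
(* on the square pi |x|^2 <= 8 rho^2 <= m / 8 <= (p k).1 / 2 for k < K *)
pose rho := Num.min 4^-1 (m / 16).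
have rho0 : 0 < rho by rewrite lt_min invr_gt0 divr_gt0 ?ltr0n.
have rho1 : rho <= 4^-1 by rewrite ge_min lexx.
have rho2 : rho <= m / 16 by rewrite ge_min lexx orbT.
exists rho; first by rewrite rho0; lra.
apply: filterS (complex_series_cvg hi hB) => x cx xs.
apply: lt_le_trans (le_trans (ler_norm _) (Re_le_cmod _)).
apply: (@lt_le_trans _ _ (K%:R / 2 - 1)); first by lra.
rewrite -(cvg_lim (@Rhausdorff R) cx); apply: limr_ge; first by apply/cvg_ex; eexists; exact: cx.
exists K => // n Kn; rewrite /series /= big_mkord.
have gE k : complex.Re (gauss2 (p k).1^-1%:C x) = expR (- (pi * dot2 x x / (p k).1)).
  by rewrite /gauss2 /cexp /= !mulr0 mul0r !oppr0 !addr0 oppr0 cos0 mulr1.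
(* the first K Gaussians are at least 1 / 2 on the square, the others at least 0 *)
have lower k : (if (k < K)%N then 2^-1 else 0) - del k <= complex.Re (h k x).
  have [/andP[pk _] /(_ x) ek _ _ _] := hp k.
  rewrite /h /bump cReD gE; have -> : complex.Re (-1 * (p k).2 x) = - complex.Re ((p k).2 x).
    by case: ((p k).2 x) => u v /=; ring.
  apply: lerD; last first.
    by rewrite lerN2; apply: le_trans ek; apply: le_trans (Re_le_cmod _); exact: ler_norm.
  case: ifP => [kK|_]; last exact: expR_ge0.
  apply: le_trans (expR_ge1Dx _); rewrite -[X in X <= _](_ : 1 - 2^-1 = _); last by field.
  rewrite lerD2l lerN2 ler_pdivrMr //.
  apply: le_trans (_ : 4 * (2 * rho ^+ 2) <= _).
    apply: ler_pM; rewrite ?pi_ge0 ?dot2_ge0 ?square_dot2 //.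
    by have := pihalf_lt2 R; lra.
  have := mK k kK; have : rho * rho <= 4^-1 * (m / 16) by apply: ler_pM => //; exact: ltW.
  by rewrite expr2; lra.
apply: le_trans (_ : \sum_(k < n) ((if (k < K)%N then 2^-1 else 0) - del k) <= _); last first.
  by apply: ler_sum => k _; exact: lower.
rewrite sumrB lerD // ?lerN2 ?sum_halves //.
rewrite -(subnKC Kn) big_split_ord /= [X in _ <= _ + X]big1 => [|k _].
  rewrite addr0 (eq_bigr (fun=> 2^-1)) => [|k _]; last by rewrite ltn_ord.
  by rewrite sumr_const card_ord -[leRHS]mulr_natl.
by rewrite ltnNge leq_addr.
Qed.
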